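(* Let $\mathbf{k}$ be a field with characteristic not equal to $2$. Let $\Gamma$ be a finite simple graph with vertex set $V$ and edge set $E$, in which each vertex $i\in V$ is labeled with a positive integer weight $p_i$; for $j\in E$ let $a_j,b_j$ denote its endpoints. Let $$A=\mathbf{k}\langle x_i,\ i\in V\rangle/([x_{a_j},x_{b_j}],\ j\in E),$$ the quotient of the free associative algebra graded by $|x_i|=p_i$ by the two-sided ideal generated by the indicated graded commutators. Let $$P_A(y,z)=\sum_{p,q\ge0}\dim\left(\operatorname{Tor}^A_{p,q}(\mathbf{k},\mathbf{k})\right)y^pz^q$$ be the double Poincaré series of $A$. Then $P_A(-1,z)=c_\Gamma(z)$, where $c_\Gamma(z)$ is the clique polynomial of $\Gamma$.
   Context: The graded commutator of homogeneous elements is $[a,b]=ab-(-1)^{|a||b|}ba$. The clique polynomial of the weighted graph $\Gamma$ is $c_\Gamma(z)=\sum_{i\ge 0}\sum_{j\ge 0}(-1)^i c_{i,j}z^j$, where $c_{i,j}$ is the number of complete subgraphs of $\Gamma$ with $i$ vertices whose weights sum to $j$ (with $c_{0,0}=1$ for the empty clique). $\operatorname{Tor}^A_{p,q}(\mathbf{k},\mathbf{k})$ denotes the component of $\operatorname{Tor}^A_p(\mathbf{k},\mathbf{k})$ in internal grading $q$ (the grading coming from a graded free $A$-resolution of $\mathbf{k}$, where $\mathbf{k}$ is the trivial $A$-module on which all $x_i$ act as zero); each of these components is finite dimensional. *)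

(* Defs.v *)
From HB Require Import structures.
From mathcomp Require Import all_boot all_algebra finmap.
From mathcomp.classical Require Import boolp.
From mathcomp.multinomials Require Import monalg.

Set Implicit Arguments.
Unset Strict Implicit.
Unset Printing Implicit Defensive.

Import GRing.Theory.

Local Open Scope ring_scope.
Local Open Scope quotient_scope.

Section TwoSidedIdeal.
Variables (R : nzRingType) (S : R -> Prop).

Inductive gen_ideal : R -> Prop :=
| gen_ideal_gen r : S r -> gen_ideal r
| gen_ideal0 : gen_ideal 0
| gen_idealD r s : gen_ideal r -> gen_ideal s -> gen_ideal (r + s)
| gen_idealMl a r : gen_ideal r -> gen_ideal (a * r)
| gen_idealMr a r : gen_ideal r -> gen_ideal (r * a).

End TwoSidedIdeal.

(* The monomials {fmonom V} are the words in V, so this is k<x_i, i in V>. *)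
Notation free_alg k V :=
  (@malg ({fmonom V} : monomType) (k : nzRingType)).

Section GraphAlgebra.
Variables (k : fieldType) (V : finType) (e : rel V) (p : V -> nat).

Definition free_gen (i : V) : free_alg k V := << fmu i >>.

Definition word_weight (m : {fmonom V}) : nat :=
  (\sum_(i <- (m : seq V)) p i)%N.

Definition graded_commutator (m n : nat) (a b : free_alg k V) : free_alg k V :=
  a * b - (-1) ^+ (m * n) * (b * a).

(* Each edge contributes a relator for both orderings of its endpoints; these
   two relators agree up to sign. *)
Definition graph_relator (r : free_alg k V) : Prop :=
  exists a b, e a b /\
    r = graded_commutator (p a) (p b) (free_gen a) (free_gen b).

Definition graph_ideal (f : free_alg k V) : bool :=
  `[< gen_ideal graph_relator f >].

Lemma graph_idealP f : reflect (gen_ideal graph_relator f) (f \in graph_ideal).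
Proof. exact: asboolP. Qed.

Lemma graph_ideal_zmod : zmod_closed graph_ideal.
Proof.
split; first by apply/graph_idealP; exact: gen_ideal0.
move=> x y /graph_idealP hx /graph_idealP hy; apply/graph_idealP.
by apply: gen_idealD => //; rewrite -mulN1r; exact: gen_idealMl.
Qed.

HB.instance Definition _ :=
  GRing.isZmodClosed.Build (free_alg k V) graph_ideal graph_ideal_zmod.

Lemma graph_idealD x y :
  x \in graph_ideal -> y \in graph_ideal -> x + y \in graph_ideal.
Proof.
move=> /graph_idealP hx /graph_idealP hy; apply/graph_idealP.
exact: gen_idealD.
Qed.

Lemma graph_idealMl a x : x \in graph_ideal -> a * x \in graph_ideal.
Proof. by move=> /graph_idealP h; apply/graph_idealP; exact: gen_idealMl. Qed.

Lemma graph_idealMr a x : x \in graph_ideal -> x * a \in graph_ideal.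
Proof. by move=> /graph_idealP h; apply/graph_idealP; exact: gen_idealMr. Qed.

Lemma free_alg_coeff1M (f g : free_alg k V) :
  (f * g)@_mone = f@_mone * g@_mone.
Proof. exact: rmorphM. Qed.

Lemma free_alg_constC c (f : free_alg k V) : c%:MP * f = f * c%:MP.
Proof.
rewrite malgM_def fgmulUg [RHS]fgmulgU.
by apply: eq_bigr => m _; rewrite mulrC mul1m mulm1.
Qed.

Lemma graph_ideal_coeff1 (x : free_alg k V) : x \in graph_ideal -> x@_mone = 0.
Proof.
have gen0 i : (free_gen i)@_mone = 0.
  by rewrite /free_gen mcoeffU fm1_eq1 mulr0n.
move=> /graph_idealP; elim=> {x}
  [_ [a [b [_ ->]]]||r s _ hr _ hs|a r _ hr|a r _ hr].
- rewrite mcoeffB [X in X - _]free_alg_coeff1M [X in _ - X]free_alg_coeff1M.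
  by rewrite [X in _ - _ * X]free_alg_coeff1M !gen0 !mulr0 subrr.
- by rewrite mcoeff0.
- by rewrite mcoeffD hr hs addr0.
- by rewrite rmorphM /= hr mulr0.
- by rewrite rmorphM /= hr mul0r.
Qed.

Definition graph_alg :=
  Quotient.quot (GRing.ZmodClosed.clone (free_alg k V) graph_ideal _).

HB.instance Definition _ := GRing.Zmodule.on graph_alg.
HB.instance Definition _ := ZmodQuotient.on graph_alg.

Definition graph_alg_one : graph_alg := \pi_graph_alg 1.
Definition graph_alg_mul (a b : graph_alg) : graph_alg :=
  \pi_graph_alg (repr a * repr b).

Lemma graph_alg_piE x y :
  x - y \in graph_ideal <-> \pi_graph_alg x = \pi_graph_alg y.
Proof. by rewrite Quotient.idealrBE; split=> /eqP. Qed.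

Lemma graph_alg_pi_mul x y :
  graph_alg_mul (\pi_graph_alg x) (\pi_graph_alg y) = \pi_graph_alg (x * y).
Proof.
apply/graph_alg_piE; set x' := repr _; set y' := repr _.
have hx : x' - x \in graph_ideal by apply/graph_alg_piE; rewrite reprK.
have hy : y' - y \in graph_ideal by apply/graph_alg_piE; rewrite reprK.
have -> : x' * y' - x * y = (x' - x) * y' + x * (y' - y).
  by rewrite mulrBl mulrBr addrA subrK.
by apply: graph_idealD; [exact: graph_idealMr | exact: graph_idealMl].
Qed.

Lemma graph_alg_ind (P : graph_alg -> Prop) :
  (forall x, P (\pi_graph_alg x)) -> forall a, P a.
Proof. by move=> h a; rewrite -[a]reprK. Qed.

Fact graph_alg_mulA : associative graph_alg_mul.
Proof.
by elim/graph_alg_ind=> x; elim/graph_alg_ind=> y; elim/graph_alg_ind=> z;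
   rewrite !graph_alg_pi_mul mulrA.
Qed.

Fact graph_alg_mul1 : left_id graph_alg_one graph_alg_mul.
Proof. by elim/graph_alg_ind=> x; rewrite graph_alg_pi_mul mul1r. Qed.

Fact graph_alg_mulr1 : right_id graph_alg_one graph_alg_mul.
Proof. by elim/graph_alg_ind=> x; rewrite graph_alg_pi_mul mulr1. Qed.

Fact graph_alg_mulDl : left_distributive graph_alg_mul +%R.
Proof.
by elim/graph_alg_ind=> x; elim/graph_alg_ind=> y; elim/graph_alg_ind=> z;
   rewrite -raddfD !graph_alg_pi_mul mulrDl raddfD.
Qed.

Fact graph_alg_mulDr : right_distributive graph_alg_mul +%R.
Proof.
by elim/graph_alg_ind=> x; elim/graph_alg_ind=> y; elim/graph_alg_ind=> z;
   rewrite -raddfD !graph_alg_pi_mul mulrDr raddfD.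
Qed.

Fact graph_alg_1_neq0 : graph_alg_one != 0.
Proof.
apply/eqP; rewrite -(raddf0 \pi_graph_alg) => /graph_alg_piE.
move=> /graph_ideal_coeff1; rewrite subr0 rmorph1 => /eqP.
by rewrite oner_eq0.
Qed.

HB.instance Definition _ := GRing.Zmodule_isNzRing.Build graph_alg
  graph_alg_mulA graph_alg_mul1 graph_alg_mulr1
  graph_alg_mulDl graph_alg_mulDr graph_alg_1_neq0.

Fact graph_alg_pi_mulr :
  {morph \pi_graph_alg : x y / (x * y : free_alg k V) >-> x * y}.
Proof. by move=> x y; rewrite -graph_alg_pi_mul. Qed.

HB.instance Definition _ := @isNzRingQuotient.Build (free_alg k V)
  (Quotient.equiv (GRing.ZmodClosed.clone (free_alg k V) graph_ideal _))
  0 -%R +%R 1 *%R graph_alg erefl graph_alg_pi_mulr.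

Lemma graph_alg_piM x y :
  \pi_graph_alg (x * y) = \pi_graph_alg x * \pi_graph_alg y.
Proof. exact: rmorphM. Qed.

Definition graph_alg_scale (c : k) (a : graph_alg) : graph_alg :=
  \pi_graph_alg c%:MP * a.

Lemma graph_alg_scale_pi c x : 
  graph_alg_scale c (\pi_graph_alg x) = \pi_graph_alg (c *: x).
Proof. by rewrite /graph_alg_scale -graph_alg_piM mul_malgC. Qed.

Fact graph_alg_scaleA c d a :
  graph_alg_scale c (graph_alg_scale d a) = graph_alg_scale (c * d) a.
Proof.
rewrite [LHS]mulrA; congr (_ * a).
by rewrite -(graph_alg_piM c%:MP d%:MP); congr \pi_graph_alg; rewrite mpolyCM.
Qed.

Fact graph_alg_scale1 : left_id 1 graph_alg_scale.
Proof. by move=> a; rewrite /graph_alg_scale !rmorph1 mul1r. Qed.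

Fact graph_alg_scaleDr : right_distributive graph_alg_scale +%R.
Proof. by move=> c a b; rewrite /graph_alg_scale mulrDr. Qed.

Fact graph_alg_scaleDl a : {morph graph_alg_scale^~ a : c d / c + d}.
Proof. by move=> c d; rewrite /graph_alg_scale !raddfD /= mulrDl. Qed.

HB.instance Definition _ := GRing.Zmodule_isLmodule.Build k graph_alg
  graph_alg_scaleA graph_alg_scale1 graph_alg_scaleDr graph_alg_scaleDl.

Fact graph_alg_scaleAl c (a b : graph_alg) : c *: (a * b) = (c *: a) * b.
Proof. exact: mulrA. Qed.

HB.instance Definition _ :=
  GRing.Lmodule_isLalgebra.Build k graph_alg graph_alg_scaleAl.

Fact graph_alg_scaleAr c (a b : graph_alg) : c *: (a * b) = a * (c *: b).
Proof.
elim/graph_alg_ind: a => x.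
by rewrite [LHS]mulrA [RHS]mulrA -!graph_alg_piM free_alg_constC.
Qed.

HB.instance Definition _ :=
  GRing.Lalgebra_isAlgebra.Build k graph_alg graph_alg_scaleAr.

Definition graph_alg_homog (q : nat) (a : graph_alg) : Prop :=
  exists2 f : free_alg k V,
    (forall m, f@_m != 0 -> word_weight m = q) & a = \pi_graph_alg f.

(* The augmentation A -> k with x_i |-> 0, i.e. the coefficient of the empty
   word, which does not depend on the representative. *)
Definition graph_alg_aug (a : graph_alg) : k := (repr a)@_mone.

Lemma graph_alg_aug_pi x : graph_alg_aug (\pi_graph_alg x) = x@_mone.
Proof.
apply/eqP; rewrite -subr_eq0 -mcoeffB; apply/eqP/graph_ideal_coeff1.
by apply/graph_alg_piE; rewrite reprK.
Qed.

Lemma graph_alg_aug_gen i : graph_alg_aug (\pi_graph_alg (free_gen i)) = 0.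
Proof. by rewrite graph_alg_aug_pi mcoeffU fm1_eq1. Qed.

Fact graph_alg_aug_zmod : zmod_morphism graph_alg_aug.
Proof.
by elim/graph_alg_ind=> x; elim/graph_alg_ind=> y;
   rewrite -raddfB !graph_alg_aug_pi mcoeffB.
Qed.

Fact graph_alg_aug_monoid : monoid_morphism graph_alg_aug.
Proof.
split; first by rewrite -(rmorph1 \pi_graph_alg) graph_alg_aug_pi rmorph1.
by elim/graph_alg_ind=> x; elim/graph_alg_ind=> y;
   rewrite -graph_alg_piM !graph_alg_aug_pi rmorphM.
Qed.

HB.instance Definition _ :=
  GRing.isZmodMorphism.Build graph_alg k graph_alg_aug graph_alg_aug_zmod.
HB.instance Definition _ :=
  GRing.isMonoidMorphism.Build graph_alg k graph_alg_aug graph_alg_aug_monoid.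

End GraphAlgebra.

Section CliquePolynomial.
Variables (V : finType) (e : rel V) (p : V -> nat).

Definition is_clique (S : {set V}) : bool :=
  [forall a in S, forall b in S, (a != b) ==> e a b].

Definition clique_count (i j : nat) : nat :=
  #|[set S : {set V} |
      [&& is_clique S, #|S| == i & (\sum_(a in S) p a)%N == j]]|.

(* The bounds on i and j only discard terms with clique_count i j = 0. *)
Definition clique_poly : {poly int} :=
  \sum_(i < #|V|.+1) \sum_(j < (\sum_a p a)%N.+1)
    ((-1) ^+ i * (clique_count i j)%:Z) *: 'X^j.

End CliquePolynomial.

Section GradedTor.
Variables (k : fieldType) (A : algType k).
Variables (gr : nat -> A -> Prop) (aug : {rmorphism A -> k}).

(* The left A-module k on which A acts through aug. *)
Definition triv_mod (f : A -> k) : Type := k.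

HB.instance Definition _ := GRing.Zmodule.on (triv_mod aug).

Definition triv_scale (a : A) (c : triv_mod aug) : triv_mod aug :=
  aug a * (c : k).

Fact triv_scaleA a b c : triv_scale a (triv_scale b c) = triv_scale (a * b) c.
Proof. by rewrite /triv_scale rmorphM mulrA. Qed.

Fact triv_scale1 : left_id 1 triv_scale.
Proof. by move=> c; rewrite /triv_scale rmorph1 mul1r. Qed.

Fact triv_scaleDr : right_distributive triv_scale +%R.
Proof. by move=> a c d; exact: mulrDr. Qed.

Fact triv_scaleDl c : {morph triv_scale^~ c : a b / a + b}.
Proof. by move=> a b; rewrite /triv_scale rmorphD mulrDl. Qed.

HB.instance Definition _ := GRing.Zmodule_isLmodule.Build A (triv_mod aug)
  triv_scaleA triv_scale1 triv_scaleDr triv_scaleDl.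

(* {malg A[X]} is the free left A-module on X.  When each x in X has degree
   deg x, its component of degree q consists of the sums of a_x x with a_x
   homogeneous of degree q - deg x. *)
Definition free_homog (X : choiceType) (deg : X -> nat) (q : nat)
    (u : {malg A[X]}) : Prop :=
  forall x, if (deg x <= q)%N then gr (q - deg x) u@_x else u@_x = 0.

Record graded_free_resolution := GradedFreeResolution {
  res_basis : nat -> choiceType;
  res_deg : forall n, res_basis n -> nat;
  res_diff : forall n,
    {linear {malg A[res_basis n.+1]} -> {malg A[res_basis n]}};
  res_aug : {linear {malg A[res_basis 0]} -> triv_mod aug};
  res_diff_homog : forall n q u,
    free_homog (@res_deg n.+1) q u ->
    free_homog (@res_deg n) q (res_diff n u);
  res_aug_homog : forall q u,
    free_homog (@res_deg 0) q u -> q = 0 \/ res_aug u = 0;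
  res_aug_surj : forall c, exists u, res_aug u = c;
  res_exact0 : forall u, res_aug u = 0 <-> exists v, res_diff 0 v = u;
  res_exactS : forall n u,
    res_diff n u = 0 <-> exists v, res_diff n.+1 v = u
}.

(* k (x)_A {malg A[X]} is {malg k[X]}; under this identification the map
   u |-> 1 (x) u applies aug to all coordinates. *)
Definition coef_aug (X : choiceType) (u : {malg A[X]}) : {malg k[X]} :=
  \sum_(x <- msupp u) << aug u@_x *g x >>.

(* The matrix of 1 (x) f is the image under aug of the matrix of f. *)
Definition tensor_map (X Y : choiceType) (f : {malg A[X]} -> {malg A[Y]})
    (u : {malg k[X]}) : {malg k[Y]} :=
  \sum_(x <- msupp u) u@_x *: coef_aug (f << 1 *g x >>).

Variable F : graded_free_resolution.

Definition tor_homog (n q : nat) (u : {malg k[res_basis F n]}) : Prop :=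
  forall x, u@_x != 0 -> res_deg x = q.

Definition tor_diff (n : nat) :
    {malg k[res_basis F n.+1]} -> {malg k[res_basis F n]} :=
  tensor_map (res_diff F n).

Definition tor_cycle (n q : nat) : {malg k[res_basis F n]} -> Prop :=
  match n with
  | 0 => fun u => tor_homog q u
  | m.+1 => fun u => tor_homog q u /\ tor_diff u = 0
  end.

Definition tor_boundary (n q : nat) (u : {malg k[res_basis F n]}) : Prop :=
  exists2 v, tor_homog q v & tor_diff v = u.

End GradedTor.

(* For subspaces B of Z: dim (Z / B) = d, witnessed by d elements of Z whose
   classes form a basis of Z / B. *)
Definition quotient_dim (k : fieldType) (U : lmodType k) (Z B : U -> Prop)
    (d : nat) : Prop :=
  exists b : 'I_d -> U,
    [/\ forall i, Z (b i),
        forall c : 'I_d -> k, B (\sum_i c i *: b i) -> forall i, c i = 0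
      & forall u, Z u -> exists c : 'I_d -> k, B (u - \sum_i c i *: b i)].

(* dim Tor^A_{n,q}(k,k) = d, computed with the graded free resolution F. *)
Definition tor_dim (k : fieldType) (A : algType k) (gr : nat -> A -> Prop)
    (aug : {rmorphism A -> k}) (F : graded_free_resolution gr aug)
    (n q d : nat) : Prop :=
  quotient_dim (@tor_cycle k A gr aug F n q) (@tor_boundary k A gr aug F n q) d.

(* A formal power series in y and z is given by its coefficients, P n q being
   that of y^n z^q.  Substituting the scalar c for y makes sense when every
   power of z occurs with finitely many powers of y only. *)
Definition series_eval_y (P : nat -> nat -> int) (c : int) (s : nat -> int) :
    Prop :=
  forall q, exists N : nat,
    (forall n, (N <= n)%N -> P n q = 0) /\ s q = \sum_(n < N) P n q * c ^+ n.

Definition double_poincare_series (k : fieldType) (A : algType k)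
    (gr : nat -> A -> Prop) (aug : {rmorphism A -> k})
    (F : graded_free_resolution gr aug) (P : nat -> nat -> int) : Prop :=
  forall n q, exists2 d : nat, tor_dim F n q d & P n q = d%:Z.

Section LinearExtension.
Variables (A : nzRingType) (Y : choiceType) (M : lmodType A) (g : Y -> M).

Definition lin_ext (v : {malg A[Y]}) : M := \sum_(y <- msupp v) v@_y *: g y.

Lemma lin_extEw (d : {fset Y}) v :
  (msupp v `<=` d)%fset -> lin_ext v = \sum_(y <- d) v@_y *: g y.
Proof.
move=> le; rewrite [LHS](big_fset_incl _ le) //= => y _ /mcoeff_outdom ->.
by rewrite scale0r.
Qed.

Lemma lin_extU a y : lin_ext << a *g y >> = a *: g y.
Proof. by rewrite (lin_extEw msuppU_le) big_seq_fset1 mcoeffUU. Qed.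

Fact lin_ext_linear : linear lin_ext.
Proof.
move=> a u v.
pose d := (msupp u `|` msupp v)%fset.
have le1 : (msupp (a *: u + v) `<=` d)%fset.
  by apply: (fsubset_trans (msuppD_le _ _)); apply: fsetSU; exact: msuppZ_le.
rewrite (lin_extEw le1) (@lin_extEw d u) ?fsubsetUl //.
rewrite (@lin_extEw d v) ?fsubsetUr //.
rewrite scaler_sumr -big_split /=; apply: eq_bigr => y _.
by rewrite mcoeffD mcoeffZ scalerDl scalerA.
Qed.

HB.instance Definition _ :=
  GRing.isLinear.Build A {malg A[Y]} M _ lin_ext lin_ext_linear.

End LinearExtension.

(* Graded free resolutions exist as soon as A is the direct sum of its graded
   components: kernels of homogeneous maps are then generated by their
   homogeneous elements. *)
Section ResolutionExists.
Variables (k : fieldType) (A : algType k).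
Variables (gr : nat -> A -> Prop) (aug : {rmorphism A -> k}).
Variable pr : nat -> A -> A.
Hypothesis prD : forall q, {morph pr q : a b / a + b}.
Hypothesis gr_pr : forall q a, gr q (pr q a).
Hypothesis pr_gr : forall q r a, gr q a -> pr r a = if r == q then a else 0.
Hypothesis pr_sum : forall a, exists N, forall M, (N <= M)%N ->
  a = \sum_(q < M) pr q a.
Hypothesis grM : forall i j a b, gr i a -> gr j b -> gr (i + j) (a * b).
Hypothesis aug_gr : forall q a, gr q a -> q = 0 \/ aug a = 0.

Hypothesis aug_scalar : forall c : k, aug c%:A = c.

Let pr0 q : pr q 0 = 0.
Proof. by apply: (addrI (pr q 0)); rewrite -prD !addr0. Qed.

Let gr0 q : gr q 0.
Proof. by rewrite -(pr0 q). Qed.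

Let grD q a b : gr q a -> gr q b -> gr q (a + b).
Proof.
move=> ha hb; have <- : pr q (a + b) = a + b; last exact: gr_pr.
by rewrite prD (pr_gr q ha) (pr_gr q hb) eqxx.
Qed.

Section Homog.
Variables (X : choiceType) (deg : X -> nat).
Implicit Types u v : {malg A[X]}.

Let hom := free_homog gr deg.

Let hom0 q : hom q 0.
Proof. by move=> x; rewrite mcoeff0; case: ifP. Qed.

Let homD q u v : hom q u -> hom q v -> hom q (u + v).
Proof.
move=> hu hv x; move: (hu x) (hv x); rewrite mcoeffD; case: ifP => _.
  exact: grD.
by move=> -> ->; rewrite addr0.
Qed.

Lemma free_homog_sum q (I : eqType) (r : seq I) (f : I -> {malg A[X]}) :
  (forall i, i \in r -> hom q (f i)) -> hom q (\sum_(i <- r) f i).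
Proof.
by move=> h; rewrite big_seq; apply: (big_ind (hom q)) => //; exact: homD.
Qed.

Lemma free_homogZ i q a u : gr i a -> hom q u -> hom (i + q) (a *: u).
Proof.
move=> ha hu x; have := hu x; rewrite mcoeffZ; case: ifP => hx.
  by rewrite (leq_trans hx (leq_addl _ _)) -addnBA //; exact: grM.
by move=> ->; rewrite mulr0; case: ifP.
Qed.

Definition free_pr q u : {malg A[X]} :=
  [malg x in msupp u => if (deg x <= q)%N then pr (q - deg x) u@_x else 0].

Lemma free_prE q u x :
  (free_pr q u)@_x = if (deg x <= q)%N then pr (q - deg x) u@_x else 0.
Proof.
by rewrite mcoeffE; case: (msuppP u x) => // _; rewrite pr0 if_same.
Qed.

Lemma free_prD q : {morph free_pr q : u v / u + v}.
Proof.
move=> u v; apply/malgP => x; rewrite mcoeffD !free_prE mcoeffD.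
by case: ifP => _; rewrite ?prD ?addr0.
Qed.

Lemma free_pr0 q : free_pr q 0 = 0.
Proof. by apply: (addrI (free_pr q 0)); rewrite -free_prD !addr0. Qed.

Lemma free_pr_homog q u : hom q (free_pr q u).
Proof.
by move=> x; rewrite free_prE; case: (deg x <= q)%N => //; exact: gr_pr.
Qed.

Lemma free_homog_pr q r u : hom q u -> free_pr r u = if r == q then u else 0.
Proof.
move=> hu; apply/malgP => x; rewrite free_prE (fun_if (mcoeff x)) mcoeff0.
have := hu x; case: (leqP (deg x) q) => hq; last first.
  by move=> ->; rewrite pr0 !if_same.
move=> /pr_gr ->; case: (leqP (deg x) r) => hr.
  by rewrite -(eqn_add2r (deg x)) !subnK.
by case: eqVneq => // E; rewrite E ltnNge hq in hr.
Qed.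

Lemma free_pr_sum u : exists N, forall M, (N <= M)%N ->
  u = \sum_(q < M) free_pr q u.
Proof.
rewrite [u]monalgE; apply: (big_ind (fun u => exists N, forall M, (N <= M)%N ->
  u = \sum_(q < M) free_pr q u)) => [|v w [N hN] [N' hN']|x _].
- by exists 0%N => M _; rewrite big1 // => q _; rewrite free_pr0.
- exists (maxn N N') => M; rewrite geq_max => /andP[h h'].
  rewrite [in LHS](hN _ h) [in LHS](hN' _ h') -big_split.
  by apply: eq_bigr => q _; rewrite free_prD.
- have [N hN] := pr_sum u@_x; exists (deg x + N)%N => M hM.
  apply/malgP => y; rewrite raddf_sum /= mcoeffU.
  have [E|xy] := eqVneq x y; last first.
    rewrite mulr0n big1 // => q _; rewrite free_prE mcoeffU (negPf xy) mulr0n.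
    by rewrite pr0 if_same.
  rewrite mulr1n; move: hM; set a := u@_x in hN *; rewrite E => hM.
  under eq_bigr do rewrite free_prE mcoeffUU.
  rewrite -(big_mkord xpredT
    (fun q => if (deg y <= q)%N then pr (q - deg y) a else 0)).
  rewrite -big_mkcond /= -(big_nat_widenl _ _ M xpredT) //.
  rewrite -{1}(add0n (deg y)) big_addn big_mkord.
  under eq_bigr do rewrite addnK.
  by apply: hN; rewrite leq_subRL ?(leq_trans (leq_addr _ _) hM).
Qed.
End Homog.

Record res_stage := ResStage {
  stage_basis : choiceType;
  stage_deg : stage_basis -> nat;
  stage_ker : {malg A[stage_basis]} -> Prop;
  stage_ker0 : stage_ker 0;
  stage_kerD : forall u v, stage_ker u -> stage_ker v -> stage_ker (u + v);
  stage_kerZ : forall a u, stage_ker u -> stage_ker (a *: u);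
  stage_ker_pr : forall q u, stage_ker u -> stage_ker (free_pr stage_deg q u)
}.

Section Next.
Variable s : res_stage.

Definition next_pred (y : nat * {malg A[stage_basis s]}) : bool :=
  `[< stage_ker y.2 /\ free_homog gr (@stage_deg s) y.1 y.2 >].

Definition next_basis : choiceType := {y | next_pred y}.

Definition next_deg (y : next_basis) : nat := (val y).1.

Definition next_diff : {malg A[next_basis]} -> {malg A[stage_basis s]} :=
  lin_ext (fun y : next_basis => (val y).2).

HB.instance Definition _ := GRing.Linear.on next_diff.

Lemma next_diff_homog q v :
  free_homog gr next_deg q v -> free_homog gr (@stage_deg s) q (next_diff v).
Proof.
move=> hv; apply: free_homog_sum => y _.
have := hv y; case: ifP => [hq hy|_ ->]; last first.
  by rewrite scale0r => x; rewrite mcoeff0; case: ifP.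
rewrite -(subnK hq); apply: free_homogZ => //.
by have /asboolP[] := valP y.
Qed.

Lemma next_diff_image u : stage_ker u <-> exists v, next_diff v = u.
Proof.
split=> [hu|[v <-]]; last first.
  rewrite /next_diff /lin_ext; apply: (big_ind (@stage_ker s)).
  - exact: stage_ker0.
  - exact: stage_kerD.
  - by move=> y _; apply: stage_kerZ; have /asboolP[] := valP y.
have [N /(_ N (leqnn N)) ->] := free_pr_sum (@stage_deg s) u.
apply: (big_ind (fun u => exists v, next_diff v = u)).
- by exists 0; rewrite raddf0.
- by move=> _ _ [v <-] [w <-]; exists (v + w); rewrite raddfD.
move=> q _.
have hy : next_pred (val q, free_pr (@stage_deg s) q u).
  by apply/asboolP; split=> /=; [exact: stage_ker_pr | exact: free_pr_homog].
exists << 1 *g (exist (fun y => next_pred y) _ hy : next_basis) >>.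
by rewrite /next_diff lin_extU scale1r.
Qed.

Lemma next_diff_pr q v :
  next_diff (free_pr next_deg q v) = free_pr (@stage_deg s) q (next_diff v).
Proof.
have [N /(_ (maxn N q.+1) (leq_maxl _ _)) ev] := free_pr_sum next_deg v.
rewrite [in RHS]ev raddf_sum.
rewrite (big_morph _ (free_prD _ _) (free_pr0 _ _)) /=.
have hq : (q < maxn N q.+1)%N by rewrite leq_max ltnSn orbT.
have H i : free_homog gr (@stage_deg s) i (next_diff (free_pr next_deg i v)).
  by apply: next_diff_homog; exact: free_pr_homog.
rewrite (bigD1 (Ordinal hq)) //= big1 ?addr0 => [|i hi].
  by rewrite (free_homog_pr q (H q)) eqxx.
rewrite (free_homog_pr q (H i)) ifN_eq //.
by apply: contraNneq hi => E; apply/eqP/val_inj.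
Qed.

Definition next_stage : res_stage.
Proof.
apply: (@ResStage next_basis next_deg (fun v => next_diff v = 0)).
- by rewrite raddf0.
- by move=> u v hu hv; rewrite raddfD /= hu hv addr0.
- by move=> a u hu; rewrite linearZ_LR /= hu scaler0.
- by move=> q u hu; rewrite next_diff_pr hu free_pr0.
Defined.

End Next.

Definition stage0_aug (u : {malg A[unit]}) : triv_mod aug := aug u@_tt.

Fact stage0_aug_linear : linear stage0_aug.
Proof.
by move=> a u v; rewrite /stage0_aug mcoeffD mcoeffZ rmorphD rmorphM.
Qed.

HB.instance Definition _ := GRing.isLinear.Build A {malg A[unit]}
  (triv_mod aug) _ stage0_aug stage0_aug_linear.

Lemma stage0_aug_pr q u :
  stage0_aug u = 0 -> stage0_aug (free_pr (fun=> 0%N) q u) = 0.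
Proof.
rewrite /stage0_aug free_prE subn0 /= => hu.
have [->|q0] := eqVneq q 0%N; last first.
  by case: (aug_gr (gr_pr q u@_tt)) => // E; rewrite E eqxx in q0.
have [N /(_ N.+1 (leqnSn N)) E] := pr_sum u@_tt.
move: hu; rewrite [in aug _]E raddf_sum big_ord_recl /= big1 ?addr0 // => i _.
by case: (aug_gr (gr_pr (lift ord0 i) u@_tt)).
Qed.

Definition stage0 : res_stage.
Proof.
apply: (@ResStage unit (fun=> 0%N) (fun u => stage0_aug u = 0)).
- by rewrite raddf0.
- by move=> u v hu hv; rewrite raddfD /= hu hv addr0.
- by move=> a u hu; rewrite linearZ_LR /= hu scaler0.
- exact: stage0_aug_pr.
Defined.

Fixpoint stage n := if n is m.+1 then next_stage (stage m) else stage0.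

Lemma graded_free_resolution_exists :
  inhabited (graded_free_resolution gr aug).
Proof.
split; apply: (@GradedFreeResolution _ _ _ _ (fun n => stage_basis (stage n))
  (fun n => @stage_deg (stage n))
  (fun n => @next_diff (stage n)) stage0_aug).
- by move=> n q u; exact: next_diff_homog.
- move=> q u /(_ tt); rewrite /= subn0 => h.
  by case: (aug_gr h) => [->|]; [left|right].
- move=> c; exists << (c : k)%:A *g tt >>.
  apply: etrans (aug_scalar c); congr (aug _); exact: mcoeffUU.
- by move=> u; exact: (@next_diff_image stage0).
- by move=> n u; exact: (@next_diff_image (stage n.+1)).
Qed.

End ResolutionExists.

Section GraphResolutionExists.
Variables (k : fieldType) (V : finType) (e : rel V) (p : V -> nat).

Let A := graph_alg k e p.
Let wt := word_weight p.

Definition word_pr (q : nat) (f : free_alg k V) : free_alg k V :=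
  [malg m in msupp f => if wt m == q then f@_m else 0].

Lemma word_prE q f m : (word_pr q f)@_m = if wt m == q then f@_m else 0.
Proof. by rewrite mcoeffE; case: msuppP => //; rewrite if_same. Qed.

Lemma word_prB q : {morph word_pr q : f g / f - g}.
Proof.
move=> f g; apply/malgP => m; rewrite mcoeffB !word_prE mcoeffB.
by case: ifP; rewrite ?subr0.
Qed.

HB.instance Definition _ q := GRing.isZmodMorphism.Build
  (free_alg k V) (free_alg k V) (word_pr q) (word_prB q).

Lemma word_prD q f g : word_pr q (f + g) = word_pr q f + word_pr q g.
Proof. exact: raddfD. Qed.

Lemma word_pr0 q : word_pr q 0 = 0.
Proof. exact: raddf0. Qed.

Lemma word_prU q c m :
  word_pr q << c *g m >> = if wt m == q then << c *g m >> else 0.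
Proof.
apply/malgP => n; rewrite word_prE (fun_if (mcoeff n)) mcoeff0 mcoeffU.
by case: (eqVneq m n) => [->|_]; rewrite ?mulr0n ?if_same.
Qed.

Lemma word_weightM m n : wt (mmul m n) = (wt m + wt n)%N.
Proof. by rewrite /wt /word_weight fmM big_cat. Qed.

Lemma malg_ind (P : free_alg k V -> Prop) : P 0 ->
  (forall f g, P f -> P g -> P (f + g)) -> (forall c m, P << c *g m >>) ->
  forall f, P f.
Proof. by move=> h0 hD hU f; rewrite [f]monalgE; apply: (big_ind P). Qed.

Lemma word_prUM q c m g : word_pr q (<< c *g m >> * g) =
  if (wt m <= q)%N then << c *g m >> * word_pr (q - wt m)%N g else 0.
Proof.
elim/malg_ind: g => [|f g hf hg|d n].
- by rewrite mulr0 !word_pr0 mulr0 if_same.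
- rewrite mulrDr [LHS]word_prD; apply: etrans (congr2 +%R hf hg) _.
  by case: (_ <= _)%N; rewrite ?addr0 // word_prD mulrDr.
- rewrite malgM_def fgmulUU !word_prU word_weightM.
  case: leqP => h; last by rewrite gtn_eqF // ltn_addr.
  rewrite -{1}(subnKC h) eqn_add2l; case: ifP => _; last by rewrite mulr0.
  by rewrite malgM_def fgmulUU.
Qed.

Lemma word_prM_ideal q r f :
  (forall i, word_pr i r \in graph_ideal e p) ->
  word_pr q (f * r) \in graph_ideal e p.
Proof.
move=> hr; elim/malg_ind: f => [|f g hf hg|c m].
- by rewrite mul0r word_pr0; apply/graph_idealP; exact: gen_ideal0.
- by rewrite mulrDl; have := graph_idealD hf hg; rewrite -word_prD.
- rewrite word_prUM; case: ifP => _; first exact: graph_idealMl.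
  by apply/graph_idealP; exact: gen_ideal0.
Qed.

Lemma word_prMU q c m g : word_pr q (g * << c *g m >>) =
  if (wt m <= q)%N then word_pr (q - wt m)%N g * << c *g m >> else 0.
Proof.
elim/malg_ind: g => [|f g hf hg|d n].
- by rewrite mul0r !word_pr0 mul0r if_same.
- rewrite mulrDl [LHS]word_prD; apply: etrans (congr2 +%R hf hg) _.
  by case: (_ <= _)%N; rewrite ?addr0 // word_prD mulrDl.
- rewrite malgM_def fgmulUU !word_prU word_weightM.
  case: leqP => h; last by rewrite gtn_eqF // ltn_addl.
  rewrite -{1}(subnK h) eqn_add2r; case: ifP => _; last by rewrite mul0r.
  by rewrite malgM_def fgmulUU.
Qed.

Lemma word_prMr_ideal q r f :
  (forall i, word_pr i r \in graph_ideal e p) ->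
  word_pr q (r * f) \in graph_ideal e p.
Proof.
move=> hr; elim/malg_ind: f => [|f g hf hg|c m].
- by rewrite mulr0 word_pr0; apply/graph_idealP; exact: gen_ideal0.
- by rewrite mulrDr; have := graph_idealD hf hg; rewrite -word_prD.
- rewrite word_prMU; case: ifP => _; first exact: graph_idealMr.
  by apply/graph_idealP; exact: gen_ideal0.
Qed.

Lemma word_pr_homog q r f : (forall m, f@_m != 0 -> wt m = r) ->
  word_pr q f = if q == r then f else 0.
Proof.
move=> hf; apply/malgP => m; rewrite word_prE (fun_if (mcoeff m)) mcoeff0.
have [->|/hf <-] := eqVneq f@_m 0; first by rewrite !if_same.
by rewrite eq_sym.
Qed.

Lemma word_pr_ideal q f :
  f \in graph_ideal e p -> word_pr q f \in graph_ideal e p.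
Proof.
move=> /graph_idealP hf; elim: hf q => {f}
  [f hf||r s _ hr _ hs|a r _ hr|a r _ hr] q.
- have [r hr] : exists r, forall m, f@_m != 0 -> wt m = r.
    case: hf => a [b [_ ->]]; exists (p a + p b)%N => m.
    rewrite /graded_commutator -signr_odd mulr_sign mcoeffB.
    rewrite (fun_if (mcoeff m)) mcoeffN !malgM_def !fgmulUU !mcoeffU mul1r.
    have wtU x y : wt (mmul (fmu x) (fmu y)) = (p x + p y)%N.
      by rewrite word_weightM /wt /word_weight !fmU !big_seq1.
    case: (eqVneq (mmul (fmu a) (fmu b)) m) => [<- _|_]; first exact: wtU.
    case: (eqVneq (mmul (fmu b) (fmu a)) m) => [<- _|_].
      by rewrite wtU addnC.
    by rewrite mulr0n oppr0 if_same subrr eqxx.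
  rewrite (word_pr_homog q hr); case: ifP => _; apply/graph_idealP.
    exact: gen_ideal_gen.
  exact: gen_ideal0.
- by rewrite word_pr0; apply/graph_idealP; exact: gen_ideal0.
- by rewrite word_prD; apply: graph_idealD (hr q) (hs q).
- exact: word_prM_ideal.
- exact: word_prMr_ideal.
Qed.

Let pr q (a : A) : A := \pi_A (word_pr q (repr a)).

Let pr_pi q f : pr q (\pi_A f) = \pi_A (word_pr q f).
Proof.
apply/graph_alg_piE; rewrite -raddfB; apply: word_pr_ideal.
by apply/graph_alg_piE; rewrite reprK.
Qed.

Lemma graph_alg_resolution_exists :
  inhabited (graded_free_resolution (@graph_alg_homog k V e p)
                                    (@graph_alg_aug k V e p)).
Proof.
apply: (@graded_free_resolution_exists _ _ _ _ pr).
- move=> q; elim/graph_alg_ind=> f; elim/graph_alg_ind=> g.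
  by rewrite -raddfD !pr_pi word_prD raddfD.
- move=> q a; exists (word_pr q (repr a)) => // m.
  by rewrite word_prE; case: (wt m =P q) => //; rewrite eqxx.
- move=> q r a [f hf ->]; rewrite pr_pi (word_pr_homog r hf).
  by case: ifP => _ //; rewrite raddf0.
- elim/graph_alg_ind=> f.
  have [N hN] : exists N, forall M, (N <= M)%N -> f = \sum_(q < M) word_pr q f.
    elim/malg_ind: f => [|f g [N hN] [N' hN']|c m].
    + by exists 0%N => M _; rewrite big1 // => q _; rewrite word_pr0.
    + exists (maxn N N') => M; rewrite geq_max => /andP[h h'].
      rewrite [in LHS](hN _ h) [in LHS](hN' _ h') -big_split.
      by apply: eq_bigr => q _; rewrite word_prD.
    + exists (wt m).+1 => M hM; rewrite (bigD1 (Ordinal hM)) //= big1.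
        by rewrite addr0 word_prU eqxx.
      move=> q hq; rewrite word_prU ifN_eq //.
      by apply: contraNneq hq => E; apply/eqP/val_inj.
  exists N => M h; rewrite [in LHS](hN M h) raddf_sum.
  by apply: eq_bigr => q _; rewrite pr_pi.
- move=> i j a b [f hf ->] [g hg ->]; exists (f * g); last first.
    by rewrite graph_alg_piM.
  move=> m; rewrite mcoeff_neq0 => /msuppM_le [m1 [m2 [h1 h2 ->]]].
  by rewrite [LHS]word_weightM /wt (hf m1) ?(hg m2) // mcoeff_neq0.
- move=> q a [f hf ->]; rewrite /= graph_alg_aug_pi.
  have [->|/hf <-] := eqVneq f@_mone 0; [by right|left].
  by rewrite /word_weight fm1 big_nil.
- move=> c; have -> : c%:A = \pi_A c%:MP :> A by exact: mulr1.
  by rewrite /= graph_alg_aug_pi; exact: mcoeffUU.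
Qed.

End GraphResolutionExists.

(* Main.v *)
Require Import Defs.
From HB Require Import structures.
From mathcomp Require Import all_boot all_algebra finmap.
From mathcomp.classical Require Import boolp.
From mathcomp.multinomials Require Import monalg.

(* The trivial module k has a Koszul resolution K over A, where K_n is free on
   the cliques S with n vertices and
     d e_S = \sum_(s in S) (-1)^N(S, s) x_s e_(S \ s).
   The algebra has partial right divisions: D_v (f x_v) = f, and D_v (f x_s) is
   up to sign (D_v f) x_s or 0 according to whether s <> v is adjacent to v.
   The k-linear map h_v (f e_S) = +- (D_v f) e_(v |: S), zero unless v |: S is a
   clique with one more vertex, makes d h_v + h_v d diagonal in the basis
   (e_S), with entry the identity whenever v lies in S.  Hence the composite
   over all vertices v of 1 - (d h_v + h_v d) is homotopic to the identity and
   vanishes in positive degrees, so K is exact.  Since K is minimal, comparing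
   an arbitrary graded free resolution with K gives
   dim Tor_(n, q) = c_(n, q), whence the identity of generating series. *)

Set Implicit Arguments.
Unset Strict Implicit.
Unset Printing Implicit Defensive.

Import GRing.Theory.

Local Open Scope ring_scope.
Local Open Scope quotient_scope.

(** * Dependent choice and linear maps out of free modules *)

(** Chain maps and homotopies are built degree by degree, and their type changes with the degree.
    [P] is the invariant carried along the recursion, [R] the relation between consecutive
    degrees. *)
Lemma dependent_choice_nat (T : nat -> Type) (P : forall n, T n -> Prop)
    (R : forall n, T n -> T n.+1 -> Prop) (x0 : T 0) :
  P 0 x0 -> (forall n x, P n x -> exists2 y, R n x y & P n.+1 y) ->
  exists f : forall n, T n,
    [/\ f 0 = x0, forall n, P n (f n) & forall n, R n (f n) (f n.+1)].
Proof.
move=> h0 hS.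
have step n (x : {x : T n | P n x}) :
    {y : {y : T n.+1 | P n.+1 y} | R n (sval x) (sval y)}.
  apply: cid; have [y hR hP] := hS n _ (svalP x).
  by exists (exist _ y hP).
pose g := nat_rect (fun n => {x : T n | P n x}) (exist _ x0 h0)
  (fun n x => sval (step n x)).
exists (fun n => sval (g n)); split=> // n; first exact: svalP.
exact: (svalP (step n (g n))).
Qed.

Lemma scale_malgU (R : nzRingType) (X : choiceType) (c : R) (x : X) :
  c *: << x >> = << c *g x >>.
Proof. by apply/malgP=> y; rewrite mcoeffZ !mcoeffU mulr_natr. Qed.

Lemma malg_expand (R : nzRingType) (X : choiceType) (u : {malg R[X]}) :
  u = \sum_(x <- msupp u) u@_x *: << x >>.
Proof.
by rewrite [LHS]monalgE; apply: eq_bigr => x _; rewrite scale_malgU.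
Qed.

Lemma linear_malg_eq (R : nzRingType) (X : choiceType) (M : lmodType R)
    (f g : {linear {malg R[X]} -> M}) :
  (forall x, f << x >> = g << x >>) -> f =1 g.
Proof.
move=> h u; rewrite [u]malg_expand !linear_sum.
by apply: eq_bigr => x _; rewrite !linearZ_LR /= h.
Qed.

(** * Base change of free modules along the augmentation *)

Section Tensor.
Variables (k : fieldType) (A : algType k) (aug : {rmorphism A -> k}).
Variables X Y : choiceType.
Local Notation coef_aug := (coef_aug aug).

Lemma coef_augE (T : choiceType) (u : {malg A[T]}) x :
  (coef_aug u)@_x = aug u@_x.
Proof.
rewrite raddf_sum /=; have [hx|hx] := boolP (x \in msupp u).
  rewrite (big_fsetD1 x) //= mcoeffUU big1_fset ?addr0 // => y.
  by rewrite !inE mcoeffU => /andP[/negPf-> _].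
rewrite big1_fset ?(mcoeff_outdom hx) ?rmorph0 // => y hy _.
by rewrite mcoeffU; case: eqP hy hx => // -> ->.
Qed.

Fact coef_aug_zmod (T : choiceType) : zmod_morphism (@Defs.coef_aug k A aug T).
Proof.
by move=> u v; apply/malgP=> x; rewrite !(coef_augE, mcoeffB) rmorphB.
Qed.

HB.instance Definition _ (T : choiceType) := GRing.isZmodMorphism.Build
  {malg A[T]} {malg k[T]} (@Defs.coef_aug k A aug T) (@coef_aug_zmod T).

Lemma coef_augZ (T : choiceType) a (u : {malg A[T]}) :
  coef_aug (a *: u) = aug a *: coef_aug u.
Proof. by apply/malgP=> x; rewrite mcoeffZ !coef_augE mcoeffZ rmorphM. Qed.

Lemma coef_augB (T : choiceType) (u v : {malg A[T]}) :
  coef_aug (u - v) = coef_aug u - coef_aug v.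
Proof. exact: (raddfB (@Defs.coef_aug k A aug T)). Qed.

Lemma coef_augD (T : choiceType) (u v : {malg A[T]}) :
  coef_aug (u + v) = coef_aug u + coef_aug v.
Proof. exact: (raddfD (@Defs.coef_aug k A aug T)). Qed.

Lemma coef_aug_sum (T : choiceType) (I : Type) (r : seq I)
    (f : I -> {malg A[T]}) :
  coef_aug (\sum_(i <- r) f i) = \sum_(i <- r) coef_aug (f i).
Proof. exact: (raddf_sum (@Defs.coef_aug k A aug T)). Qed.

Lemma coef_augU (T : choiceType) (x : T) : coef_aug << x >> = << x >>.
Proof.
by apply/malgP=> y; rewrite coef_augE !mcoeffU raddfMn /= rmorph1.
Qed.

(* [tensor_map aug f], to which it is convertible, as a linear map. *)
Definition tensor_ext (f : {malg A[X]} -> {malg A[Y]}) :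
    {linear {malg k[X]} -> {malg k[Y]}} :=
  lin_ext (fun x => coef_aug (f << x >>)).

Lemma tensor_extU f x : tensor_ext f << x >> = coef_aug (f << x >>).
Proof. by rewrite /tensor_ext /= lin_extU scale1r. Qed.

(** Base change is functorial because [f] is linear over [A] and [aug] is multiplicative. Through
    this square, identities between [A]-linear maps pass to their reductions over [k]. *)
Lemma tensor_ext_coef (f : {linear {malg A[X]} -> {malg A[Y]}}) u :
  tensor_ext f (coef_aug u) = coef_aug (f u).
Proof.
rewrite [u]malg_expand [f _]linear_sum !coef_aug_sum.
rewrite linear_sum; apply: eq_bigr => x _ /=.
by rewrite coef_augZ coef_augU linearZ_LR tensor_extU linearZ_LR coef_augZ.
Qed.

End Tensor.

(** * Comparison of graded free resolutions *)

Section Comparison.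
Variables (k : fieldType) (A : algType k).
Variables (gr : nat -> A -> Prop) (aug : {rmorphism A -> k}).
Variable pr : nat -> A -> A.
Hypothesis prD : forall q, {morph pr q : a b / a + b}.
Hypothesis gr_pr : forall q a, gr q (pr q a).
Hypothesis pr_gr : forall q r a, gr q a -> pr r a = if r == q then a else 0.
Hypothesis pr_sum : forall a, exists N, forall M, (N <= M)%N ->
  a = \sum_(q < M) pr q a.
Hypothesis grM : forall i j a b, gr i a -> gr j b -> gr (i + j) (a * b).
Hypothesis aug_gr : forall q a, gr q a -> q = 0 \/ aug a = 0.
Hypothesis gr1 : gr 0 1.

Local Notation resolution := (graded_free_resolution gr aug).
Local Notation rdeg F n := (@res_deg _ _ _ _ F n).

Let gr0 q : gr q 0.
Proof.
have <- : pr q 0 = 0 by apply: (addrI (pr q 0)); rewrite -prD !addr0.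
exact: gr_pr.
Qed.

Let homU (X : choiceType) (deg : X -> nat) x :
  free_homog gr deg (deg x) << x >>.
Proof.
move=> y; rewrite mcoeffU; case: (eqVneq x y) => [<-|_].
  by rewrite leqnn subnn.
by case: ifP.
Qed.

Let hom0 (X : choiceType) (deg : X -> nat) q : free_homog gr deg q 0.
Proof. by move=> x; rewrite mcoeff0; case: ifP. Qed.

Let homB (X : choiceType) (deg : X -> nat) q u v :
  free_homog gr deg q u -> free_homog gr deg q v ->
  free_homog gr deg q (u - v).
Proof.
move=> hu hv; have h i : i \in [:: u; - v] -> free_homog gr deg q i.
  rewrite !inE => /orP[] /eqP-> //.
  rewrite -scaleN1r -(add0n q); apply: (free_homogZ prD gr_pr grM) => //.
  have <- : pr 0 (- 1) = - 1 :> A; last exact: gr_pr.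
  apply: (addrI (pr 0 1)); rewrite -prD (pr_gr 0 gr1) eqxx !subrr.
  by rewrite (pr_gr 0 (gr0 0)).
have -> : u - v = \sum_(i <- [:: u; - v]) i.
  by rewrite !big_cons big_nil addr0.
exact: (free_homog_sum prD gr_pr pr_gr).
Qed.

(** In degree 0 the augmentation takes the place of the missing differential, so exactness reads the
    same in all degrees. *)
Definition res_cycle (F : resolution) (n : nat) :
    {malg A[res_basis F n]} -> Prop :=
  match n with
  | 0 => fun u => res_aug F u = 0
  | m.+1 => fun u => res_diff F m u = 0
  end.

Lemma res_exact (F : resolution) n (u : {malg A[res_basis F n]}) :
  res_cycle u <-> exists v, res_diff F n v = u.
Proof. by case: n u => [|n] u; [exact: res_exact0 | exact: res_exactS]. Qed.

Lemma res_cycle_diff (F : resolution) n u : res_cycle (res_diff F n u).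
Proof. by apply/res_exact; exists u. Qed.

Definition homog_map (X Y : choiceType) (degX : X -> nat) (degY : Y -> nat)
    (f : {malg A[X]} -> {malg A[Y]}) : Prop :=
  forall q u, free_homog gr degX q u -> free_homog gr degY q (f u).

(** The differential preserves degrees, so when [v] is split into homogeneous components, only the
    one of degree [q] contributes to degree [q] of the image. *)
Lemma res_diff_pr (F : resolution) n q v :
  res_diff F n (free_pr pr (rdeg F n.+1) q v) =
  free_pr pr (rdeg F n) q (res_diff F n v).
Proof.
(* The number of components is raised to at least [q.+1], so that [q] is one of the summation
   indices. *)
have [N /(_ (maxn N q.+1) (leq_maxl _ _)) ev] := free_pr_sum prD pr_sum
  (rdeg F n.+1) v.
rewrite [in RHS]ev linear_sum.
rewrite (big_morph _ (free_prD prD _ _) (free_pr0 prD _ _)) /=.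
have hq : (q < maxn N q.+1)%N by rewrite leq_max ltnSn orbT.
have H i := res_diff_homog (free_pr_homog prD gr_pr (rdeg F n.+1) i v).
rewrite (bigD1 (Ordinal hq)) //= big1 ?addr0 => [|i hi].
  by rewrite (free_homog_pr prD pr_gr q (H q)) eqxx.
rewrite (free_homog_pr prD pr_gr q (H i)) ifN_eq //.
by apply: contraNneq hi => E; apply/eqP/val_inj.
Qed.

(** The degree [q] component of an arbitrary preimage is again a preimage, by [res_diff_pr]. *)
Lemma homog_preimage (F : resolution) n q (u : {malg A[res_basis F n]}) :
  res_cycle u -> free_homog gr (rdeg F n) q u ->
  exists2 v, free_homog gr (rdeg F n.+1) q v & res_diff F n v = u.
Proof.
move=> /res_exact[v hv] hu; exists (free_pr pr (rdeg F n.+1) q v).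
  exact: (free_pr_homog prD gr_pr).
by rewrite res_diff_pr hv (free_homog_pr prD pr_gr q hu) eqxx.
Qed.

Lemma lin_ext_homog (X Y : choiceType) (degX : X -> nat) (degY : Y -> nat)
    (g : X -> {malg A[Y]}) :
  (forall x, free_homog gr degY (degX x) (g x)) ->
  homog_map degX degY (lin_ext g).
Proof.
move=> hg q u hu; apply: (free_homog_sum prD gr_pr pr_gr) => x _.
have := hu x; case: ifP => [hq hx|_ ->]; last by rewrite scale0r; exact: hom0.
by rewrite -(subnK hq); apply: (free_homogZ prD gr_pr grM); rewrite ?subnK.
Qed.

(** Graded projectivity of a free module: homogeneous preimages are chosen for the images of the
    basis elements and extended linearly. *)
Lemma homog_linear_lift (G : resolution) n (X : choiceType) (deg : X -> nat)
    (f : {linear {malg A[X]} -> {malg A[res_basis G n]}}) :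
  homog_map deg (rdeg G n) f -> (forall u, res_cycle (f u)) ->
  exists2 h : {linear {malg A[X]} -> {malg A[res_basis G n.+1]}},
    forall u, res_diff G n (h u) = f u &
    homog_map deg (rdeg G n.+1) h.
Proof.
move=> hf cf.
have /boolp.choice[g hg] : forall x, exists v,
    free_homog gr (rdeg G n.+1) (deg x) v /\
    res_diff G n v = f << x >>.
  move=> x.
  by have [v] := homog_preimage (cf << x >>) (hf _ _ (homU deg x)); exists v.
exists (lin_ext g); last by apply: lin_ext_homog => x; case: (hg x).
pose df : {linear _ -> _} := res_diff G n \o lin_ext g.
apply: (linear_malg_eq (f := df)) => x.
by rewrite /df /= lin_extU scale1r; case: (hg x).
Qed.

Lemma homog_aug_lift (F G : resolution) :
  exists2 f : {linear {malg A[res_basis F 0]} -> {malg A[res_basis G 0]}},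
    forall u, res_aug G (f u) = res_aug F u &
    homog_map (rdeg F 0) (rdeg G 0) f.
Proof.
have /boolp.choice[g hg] : forall x : res_basis F 0, exists v,
    free_homog gr (rdeg G 0) (res_deg x) v /\
    res_aug G v = res_aug F << x >>.
  move=> x.
  (* Either the basis element augments to zero, and 0 lifts it, or its degree is 0. Then the degree
     0 component of any preimage works, since the components of positive degree augment to zero. *)
  case: (res_aug_homog (homU (rdeg F 0) x)) => [->|->]; last first.
    by exists 0; split; [exact: hom0 | rewrite raddf0].
  have [u hu] := res_aug_surj G (res_aug F << x >>).
  exists (free_pr pr (rdeg G 0) 0 u); split.
    exact: (free_pr_homog prD gr_pr).
  have [N /(_ N.+1 (leqnSn N)) E] := free_pr_sum prD pr_sum
    (rdeg G 0) u.
  rewrite -hu [in RHS]E linear_sum big_ord_recl /= big1 ?addr0 // => i _.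
  by case: (res_aug_homog (free_pr_homog prD gr_pr (rdeg G 0)
    (lift ord0 i) u)).
exists (lin_ext g); last by apply: lin_ext_homog => x; case: (hg x).
pose af : {linear _ -> _} := res_aug G \o lin_ext g.
apply: (linear_malg_eq (f := af)) => x.
by rewrite /af /= lin_extU scale1r; case: (hg x).
Qed.

(** Each map of the chain is a lift of the previous one composed with the differential. The
    invariant of the recursion is that the map is homogeneous and sends cycles to cycles, which is
    what makes the next lift possible. *)
Lemma comparison_map (F G : resolution) :
  exists f : forall n, {linear {malg A[res_basis F n]} ->
                               {malg A[res_basis G n]}},
  [/\ forall n, homog_map (rdeg F n) (rdeg G n) (f n),
      forall u, res_aug G (f 0 u) = res_aug F u
    & forall n u, res_diff G n (f n.+1 u) = f n (res_diff F n u)].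
Proof.
have [f0 af0 hf0] := homog_aug_lift F G.
have [||f [ef Pf Rf]] := dependent_choice_nat (x0 := f0)
  (P := fun n (f : {linear {malg A[res_basis F n]} -> {malg A[res_basis G n]}})
    => homog_map (rdeg F n) (rdeg G n) f /\
       forall u, res_cycle u -> res_cycle (f u))
  (R := fun n f f' =>
    forall u, res_diff G n (f' u) = f (res_diff F n u)).
- by split=> // u; rewrite /= af0.
- move=> n f [hf cf]; pose fd : {linear _ -> _} := f \o res_diff F n.
  have [||f' df' hf'] := homog_linear_lift (deg := rdeg F n.+1)
    (f := fd).
  + by move=> q u /res_diff_homog /hf.
  + by move=> u; apply/cf/res_cycle_diff.
  exists f' => //; split=> // u /= hu.
  by rewrite df' /fd /= hu raddf0.
exists f; split=> // [n|u]; first by case: (Pf n).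
by rewrite ef.
Qed.

(** A chain map lifting zero is null-homotopic. The invariant is that [d h = f] on cycles; it makes
    [f - h d] in the next degree take values in cycles, and the next [h] is a lift of that
    difference. *)
Lemma null_homotopy (F G : resolution)
    (f : forall n, {linear {malg A[res_basis F n]} ->
                           {malg A[res_basis G n]}}) :
  (forall n, homog_map (rdeg F n) (rdeg G n) (f n)) ->
  (forall u, res_aug G (f 0 u) = 0) ->
  (forall n u, res_diff G n (f n.+1 u) = f n (res_diff F n u)) ->
  exists h : forall n, {linear {malg A[res_basis F n]} ->
                               {malg A[res_basis G n.+1]}},
  [/\ forall n, homog_map (rdeg F n) (rdeg G n.+1) (h n),
      forall u, f 0 u = res_diff G 0 (h 0 u)
    & forall n u,
        f n.+1 u = res_diff G n.+1 (h n.+1 u) + h n (res_diff F n u)].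
Proof.
move=> hf af df.
have [h0 dh0 hh0] := homog_linear_lift (hf 0) af.
have [||h [eh Ph Rh]] := dependent_choice_nat (x0 := h0)
  (P := fun n
      (h : {linear {malg A[res_basis F n]} -> {malg A[res_basis G n.+1]}}) =>
    homog_map (rdeg F n) (rdeg G n.+1) h /\
       forall u, res_cycle u -> res_diff G n (h u) = f n u)
  (R := fun n h h' =>
    forall u, res_diff G n.+1 (h' u) = f n.+1 u - h (res_diff F n u)).
- by split=> // u _; exact: dh0.
- move=> n h [hh dh].
  pose g : {linear _ -> _} := f n.+1 \- (h \o res_diff F n).
  have [||h' dh' hh'] := homog_linear_lift (deg := rdeg F n.+1)
    (f := g).
  + by move=> q u hu; apply: homB; [exact: hf | exact/hh/res_diff_homog].
  + move=> u /=; rewrite raddfB /= df dh ?subrr //; exact: res_cycle_diff.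
  exists h' => //; split=> // u /= hu.
  by rewrite dh' /g /= hu raddf0 subr0.
exists h; split=> [n|u|n u]; first by case: (Ph n).
- by rewrite eh dh0.
- by rewrite Rh subrK.
Qed.

Section Tensor.
Variables X Y : choiceType.

Lemma coef_aug_linear_eq (M : lmodType k)
    (f g : {linear {malg k[X]} -> M}) :
  (forall u, f (coef_aug aug u) = g (coef_aug aug u)) -> f =1 g.
Proof. by move=> h; apply: linear_malg_eq => x; rewrite -(coef_augU aug). Qed.

(** The matrix entry of [f] at [x] and [y] is homogeneous of degree [degX x - degY y], and the
    augmentation kills it unless this degree is 0. *)
Lemma tensor_ext_homog (degX : X -> nat) (degY : Y -> nat)
    (f : {linear {malg A[X]} -> {malg A[Y]}}) q (u : {malg k[X]}) :
  homog_map degX degY f -> (forall x, u@_x != 0 -> degX x = q) ->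
  forall y, (tensor_ext aug f u)@_y != 0 -> degY y = q.
Proof.
move=> hf hu y; apply: contraNeq => hy.
rewrite /tensor_ext /= /lin_ext raddf_sum big_seq big1 //= => x.
rewrite -mcoeff_neq0 => /hu hx; rewrite mcoeffZ coef_augE.
have := hf _ _ (homU degX x) y; case: ifP => [le|_ ->]; last first.
  by rewrite rmorph0 mulr0.
move=> /aug_gr[/eqP|->]; last by rewrite mulr0.
rewrite subn_eq0 hx => ge; case/eqP: hy.
by apply/eqP; rewrite eqn_leq ge -hx le.
Qed.

End Tensor.

(** [F] and [G] are homotopy equivalent, hence so are their reductions over [k]. As the reduction of
    [G] has zero differential, its basis elements of degree [q] give a basis of the homology. *)
Lemma tor_dim_minimal (F G : resolution) n q d (b : 'I_d -> res_basis G n) :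
  (forall m (u : {malg k[res_basis G m.+1]}), tor_diff u = 0) ->
  injective b -> (forall i, res_deg (b i) = q) ->
  (forall x, res_deg x = q -> exists i, b i = x) ->
  tor_dim F n q d.
Proof.
move=> G_min b_inj b_deg b_surj.
have [f [hf af df]] := comparison_map F G.
have [g [hg ag dg]] := comparison_map G F.
pose gf m : {linear _ -> _} := (g m \o f m) \- idfun.
pose fg m : {linear _ -> _} := (f m \o g m) \- idfun.
have [|||h [hh h0 hS]] := null_homotopy (f := gf).
- by move=> m r u hu; apply: homB => //; exact/hg/hf.
- by move=> u; rewrite /gf /= raddfB /= ag af subrr.
- by move=> m u; rewrite /gf /= raddfB /= dg df.
have [|||l [_ l0 lS]] := null_homotopy (f := fg).
- by move=> m r u hu; apply: homB => //; exact/hf/hg.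
- by move=> u; rewrite /fg /= raddfB /= af ag subrr.
- by move=> m u; rewrite /fg /= raddfB /= df dg.
pose fb m := tensor_ext aug (f m); pose gb m := tensor_ext aug (g m).
pose dF m := tensor_ext aug (res_diff F m).
pose dG m := tensor_ext aug (res_diff G m).
have dG0 m u : dG m u = 0 by exact: G_min.
(* As [f] and [g] commute with the differentials, [dF] after [gb], and below [fb] after [dF], factor
   through the zero differential [dG]. *)
have dgb m u : dF m (gb m.+1 u) = 0.
  pose p1 : {linear _ -> _} := dF m \o gb m.+1.
  pose p2 : {linear _ -> _} := gb m \o dG m.
  have /(_ u) : p1 =1 p2.
    apply: coef_aug_linear_eq => v.
    by rewrite /p1 /p2 /= !tensor_ext_coef dg.
  by rewrite /p1 /p2 /= dG0 raddf0.
have fbd m u : fb m (dF m u) = 0.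
  rewrite -(dG0 m (fb m.+1 u)).
  pose p1 : {linear _ -> _} := dG m \o fb m.+1.
  pose p2 : {linear _ -> _} := fb m \o dF m.
  suff /(_ u) : p1 =1 p2 by [].
  apply: coef_aug_linear_eq => v.
  by rewrite /p1 /p2 /= !tensor_ext_coef df.
(* Both terms of the homotopy from [f g] to the identity contain a differential of [G], which
   vanishes after reduction; so the composite is the identity on the nose. *)
have fgb m u : fb m (gb m u) = u.
  apply/eqP; rewrite -subr_eq0; apply/eqP.
  pose p1 : {linear _ -> _} := (fb m \o gb m) \- idfun.
  suff /(_ u) : p1 =1 \0 by [].
  apply: coef_aug_linear_eq => v; rewrite /p1 /= !tensor_ext_coef.
  rewrite -coef_augB -[_ - v]/(fg m v) {u p1}.
  case: m v => [|m] v; first by rewrite l0 -tensor_ext_coef dG0.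
  by rewrite lS coef_augD /= -!tensor_ext_coef !dG0 raddf0 addr0.
have gfb0 u : gb 0 (fb 0 u) - u = dF 0 (tensor_ext aug (h 0) u).
  pose p1 : {linear _ -> _} := (gb 0 \o fb 0) \- idfun.
  pose p2 : {linear _ -> _} := dF 0 \o tensor_ext aug (h 0).
  suff /(_ u) : p1 =1 p2 by [].
  apply: coef_aug_linear_eq => v; rewrite /p1 /p2 /= !tensor_ext_coef.
  by rewrite -coef_augB -[_ - v]/(gf 0 v) h0.
have gfbS m u : gb m.+1 (fb m.+1 u) - u =
    dF m.+1 (tensor_ext aug (h m.+1) u) + tensor_ext aug (h m) (dF m u).
  pose p1 : {linear _ -> _} := (gb m.+1 \o fb m.+1) \- idfun.
  pose p2 : {linear _ -> _} := (dF m.+1 \o tensor_ext aug (h m.+1)) \+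
    (tensor_ext aug (h m) \o dF m).
  suff /(_ u) : p1 =1 p2 by [].
  apply: coef_aug_linear_eq => v; rewrite /p1 /p2 /= !tensor_ext_coef.
  rewrite -coef_augB -coef_augD /=.
  by rewrite -[_ - v]/(gf m.+1 v) hS.
(* On cycles the second homotopy term, which starts with [dF], disappears. *)
have gfb (u : {malg k[res_basis F n]}) : tor_cycle q u ->
      gb n (fb n u) - u = dF n (tensor_ext aug (h n) u).
  case: (n) u => [|m] u /=; first by rewrite gfb0.
  by case=> _ du; rewrite gfbS [dF m u]du raddf0 addr0.
have homF (u : {malg k[res_basis F n]}) : tor_cycle q u -> tor_homog q u.
  by case: (n) u => [|m] u; [|case].

exists (fun i => gb n << b i >>); split=> [i|c|u hu].
- have hgb : tor_homog q (gb n << b i >>).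
    apply: (tensor_ext_homog (hg n)) => x; rewrite mcoeffU.
    by case: (eqVneq (b i) x) => [<- //|_]; rewrite mulr0n eqxx.
  case: (n) b {b_inj b_deg b_surj} i hgb => [|m] b i hgb //.
  by split=> //; exact: dgb.
(* Independence: [fb] kills boundaries and is a left inverse of [gb]. *)
- move=> [v _ hv] i; have := congr1 (fb n) hv.
  rewrite [tor_diff v]/(dF n v) fbd linear_sum => /(congr1 (mcoeff (b i))).
  rewrite mcoeff0 raddf_sum (bigD1 i) //= big1 => [|j ji].
    by rewrite addr0 linearZ_LR /= fgb mcoeffZ mcoeffUU mulr1 => <-.
  rewrite linearZ_LR /= fgb mcoeffZ mcoeffU (inj_eq b_inj) (negPf ji).
  by rewrite mulr0n mulr0.
(* Spanning: the coefficients are the coordinates of [fb n u], which has none outside degree [q],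
   and [gb (fb u)] differs from [u] by a boundary. *)
- exists (fun i => (fb n u)@_(b i)).
  exists (- tensor_ext aug (h n) u).
    move=> x; rewrite mcoeffN oppr_eq0.
    exact: (tensor_ext_homog (hh n) (homF u hu)).
  rewrite -[tor_diff _]/(dF n _) linearN -gfb // opprB; congr (u - _).
  rewrite -[X in gb n X](_ : \sum_i (fb n u)@_(b i) *: << b i >> = _).
    by rewrite linear_sum; apply: eq_bigr => i _; rewrite linearZ_LR.
  apply/malgP=> x; rewrite raddf_sum /=.
  have [/b_surj[i <-]|hx] := eqVneq (res_deg x) q.
    rewrite (bigD1 i) //= big1 => [|j ji].
      by rewrite addr0 mcoeffZ mcoeffUU mulr1.
    by rewrite mcoeffZ mcoeffU (inj_eq b_inj) (negPf ji) mulr0n mulr0.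
  rewrite big1 => [|i _]; last first.
    rewrite mcoeffZ mcoeffU; case: eqVneq => [E|_]; last by rewrite mulr0.
    by rewrite -E b_deg eqxx in hx.
  apply/esym/eqP; apply: contraNT hx => /(tensor_ext_homog (hf n) (homF u hu)).
  by move->.
Qed.

End Comparison.

(** * Right division in the graph algebra *)

Section Grading.
Variables (k : fieldType) (V : finType) (e : rel V) (p : V -> nat).

Local Notation A := (graph_alg k e p).
Local Notation homog := (@graph_alg_homog k V e p).
Local Notation aug := (@graph_alg_aug k V e p).

Definition graph_pr (q : nat) (a : A) : A := \pi_A (word_pr p q (repr a)).

(** Independent of the representative because the relators are homogeneous, so the ideal contains
    the components of its elements. *)
Lemma graph_pr_pi q f : graph_pr q (\pi_A f) = \pi_A (word_pr p q f).
Proof.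
apply/graph_alg_piE; rewrite -word_prB; apply: word_pr_ideal.
by apply/graph_alg_piE; rewrite reprK.
Qed.

Lemma graph_prD q : {morph graph_pr q : a b / a + b}.
Proof.
elim/graph_alg_ind=> f; elim/graph_alg_ind=> g.
by rewrite -raddfD !graph_pr_pi word_prD raddfD.
Qed.

Lemma graph_pr_homog q a : homog q (graph_pr q a).
Proof.
exists (word_pr p q (repr a)) => // m; rewrite word_prE.
by case: (word_weight p m =P q) => //; rewrite eqxx.
Qed.

Lemma homog_graph_pr q r a :
  homog q a -> graph_pr r a = if r == q then a else 0.
Proof.
case=> f hf ->; rewrite graph_pr_pi (word_pr_homog r hf).
by case: ifP; rewrite ?raddf0.
Qed.

Lemma graph_pr_sum a : exists N, forall M, (N <= M)%N ->
  a = \sum_(q < M) graph_pr q a.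
Proof.
elim/graph_alg_ind: a => f.
exists (\max_(m <- msupp f) word_weight p m).+1 => M hM.
under eq_bigr do rewrite graph_pr_pi.
rewrite -raddf_sum; congr \pi_A; apply/malgP=> m; rewrite raddf_sum /=.
under eq_bigr do rewrite word_prE.
have [|/mcoeff_outdom->] := boolP (m \in msupp f); last first.
  by rewrite big1 // => q _; rewrite if_same.
move=> hm; have lt : (word_weight p m < M)%N.
  by apply: leq_trans hM; rewrite ltnS; exact: leq_bigmax_seq.
rewrite (bigD1 (Ordinal lt)) //= eqxx big1 ?addr0 // => q /negPf.
by rewrite -val_eqE /= eq_sym => ->.
Qed.

Lemma homogM i j a b : homog i a -> homog j b -> homog (i + j) (a * b).
Proof.
case=> f hf -> [g hg ->]; exists (f * g); last by rewrite graph_alg_piM.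
move=> m; rewrite mcoeff_neq0 => /msuppM_le[m1 [m2 [h1 h2 ->]]].
by rewrite [LHS]word_weightM (hf m1) ?(hg m2) // mcoeff_neq0.
Qed.

Lemma homog_aug q a : homog q a -> q = 0 \/ aug a = 0.
Proof.
case=> f hf ->; rewrite graph_alg_aug_pi.
have [->|/hf <-] := eqVneq f@_mone 0; [by right | left].
by rewrite /word_weight fm1 big_nil.
Qed.

Lemma homog1 : homog 0 1.
Proof.
exists 1; last by rewrite rmorph1.
move=> m; rewrite mcoeff1; case: (m =P mone) => [-> _|_]; last by rewrite eqxx.
by rewrite /word_weight fm1 big_nil.
Qed.

Lemma homog_sign n q a : homog q a -> homog q ((-1) ^+ n * a).
Proof.
case=> f hf ->; exists ((-1) ^+ n * f).
2: by rewrite graph_alg_piM rmorph_sign.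
move=> m; rewrite -signr_odd mulr_sign; case: odd; last exact: hf.
by rewrite mcoeffN oppr_eq0; exact: hf.
Qed.

Definition graph_gen (v : V) : A := \pi_A (free_gen k v).
Local Notation x := graph_gen.

Lemma homog_gen v : homog (p v) (x v).
Proof.
exists (free_gen k v) => // m; rewrite mcoeffU; case: (eqVneq (fmu v) m).
  by move=> <- _; rewrite /word_weight fmU big_seq1.
by rewrite mulr0n eqxx.
Qed.

Lemma aug_gen v : aug (x v) = 0.
Proof. exact: graph_alg_aug_gen. Qed.

Lemma graph_alg_scale_malgU c (m : {fmonom V}) :
  c *: (\pi_A << m >>) = \pi_A << c *g m >>.
Proof. by rewrite -[in RHS]scale_malgU; exact: graph_alg_scale_pi. Qed.

Lemma graph_genC a b : e a b -> x a * x b = (-1) ^+ (p a * p b) * (x b * x a).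
Proof.
move=> ab; rewrite -!graph_alg_piM -(rmorph_sign \pi_A) -graph_alg_piM.
apply/graph_alg_piE/graph_idealP; apply: gen_ideal_gen.
by exists a, b.
Qed.

End Grading.

(** * Sign bookkeeping *)

Section Signs.
Variable B : nzRingType.

Lemma mulr_signCA n (g h : B) : g * ((-1) ^+ n * h) = (-1) ^+ n * (g * h).
Proof. by rewrite mulrA (commr_sign g) mulrA. Qed.

Lemma mulrACA_sign m n (g h : B) :
  (-1) ^+ m * g * ((-1) ^+ n * h) = (-1) ^+ (m + n) * (g * h).
Proof. by rewrite -mulrA mulr_signCA mulrA exprD. Qed.

Lemma addr_sign_odd m n (h : B) :
  odd (m + n) -> (-1) ^+ m * h + (-1) ^+ n * h = 0.
Proof.
rewrite oddD -(signr_odd _ m) -(signr_odd _ n).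
by case: odd; case: odd => // _; rewrite mulN1r mul1r (addNr, addrN).
Qed.

End Signs.

(* [D] plays right division by the generator [v] on the free algebra [R]. *)
Section RightDivisionIdeal.
Variables (V : finType) (e : rel V) (p : V -> nat).
Hypothesis e_sym : symmetric e.
Hypothesis e_irr : irreflexive e.
Variables (R B : nzRingType) (pr : {rmorphism R -> B}) (D : {additive R -> B}).
Variables (y : V -> R) (v : V).
Hypothesis pr_comm : forall a b, e a b ->
  pr (y a) * pr (y b) = (-1) ^+ (p a * p b) * (pr (y b) * pr (y a)).
Hypothesis D_gen : forall f a, D (f * y a) =
  if a == v then pr f
  else if e a v then (-1) ^+ (p a * p v) * D f * pr (y a) else 0.

(** If [v] is an endpoint of the edge, dividing either product leaves the other generator, with
    signs that cancel. Otherwise both letters pass through the division, and the relation in [B]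
    gives the cancellation, or a letter not adjacent to [v] makes both terms zero. *)
Lemma rdiv_relator f a b : e a b ->
  D (f * (y a * y b - (-1) ^+ (p a * p b) * (y b * y a))) = 0.
Proof.
move=> ab; have ab' : e b a by rewrite e_sym.
have neq : a != b by apply: contraTneq ab => ->; rewrite e_irr.
rewrite mulrBr raddfB /=; apply/eqP; rewrite subr_eq0; apply/eqP.
rewrite [f * (_ ^+ _ * _)]mulrA (commr_sign f) -[_ ^+ _ * f * _]mulrA.
rewrite raddfMsign.
rewrite [f * (y a * _)]mulrA [f * (y b * _)]mulrA.
have [av|av] := eqVneq a v.
  have bv : b != v by rewrite -av eq_sym.
  by rewrite !D_gen (negPf bv) av eqxx -av ab' rmorphM mulnC mulrA.
have [bv|bv] := eqVneq b v.
  rewrite !D_gen (negPf av) bv eqxx -bv ab rmorphM.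
  by rewrite -mulrA signrMK.
rewrite !D_gen (negPf av) (negPf bv).
case: (e a v); case: (e b v); rewrite ?(mulr0, mul0r) //.
have S n m l z : (-1) ^+ n * ((-1) ^+ m * ((-1) ^+ l * z)) =
    (-1) ^+ l * ((-1) ^+ m * ((-1) ^+ n * z)) :> B.
  rewrite !mulrA -!exprD; congr (_ ^+ _ * _).
  by rewrite addnC [in LHS](addnC n) addnA.
by rewrite -!mulrA pr_comm // [D f * _]mulr_signCA S.
Qed.

Hypothesis D_ker : forall f g, pr f = 0 -> D f = 0 -> D (f * g) = 0.

Lemma rdiv_ideal (S : R -> Prop) f :
  (forall r, S r -> exists a b, e a b /\
     r = y a * y b - (-1) ^+ (p a * p b) * (y b * y a)) ->
  gen_ideal S f -> D f = 0.
Proof.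
(* Factors on both sides are added so that the induction passes through left and right
   multiplication; on a generator the right factor is absorbed by [D_ker]. *)
move=> hS hf; suff h : forall g h, D (g * f * h) = 0.
  by rewrite -[f]mul1r -[_ * f]mulr1 h.
elim: hf => {f} [r /hS[a [b [ab ->]]]||r s _ hr _ hs|a r _ hr|a r _ hr] g h.
- apply: D_ker; last exact: rdiv_relator.
  by rewrite rmorphM rmorphB /= !(rmorphM, rmorph_sign) pr_comm // subrr mulr0.
- by rewrite mulr0 mul0r raddf0.
- by rewrite mulrDr mulrDl raddfD /= hr hs addr0.
- by rewrite mulrA hr.
- by rewrite mulrA -[_ * a * h]mulrA hr.
Qed.

End RightDivisionIdeal.

Section RightDivision.
Variables (k : fieldType) (V : finType) (e : rel V) (p : V -> nat).
Hypothesis e_sym : symmetric e.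
Hypothesis e_irr : irreflexive e.
Variable v : V.

Local Notation A := (graph_alg k e p).
Local Notation x := (graph_gen k e p).

(* Right division by [v] of a word given in reverse, last letter first. *)
Fixpoint rdiv_rev_word (s : seq V) : A :=
  if s is a :: s' then
    if a == v then \pi_A << FMonom (rev s') >>
    else if e a v then (-1) ^+ (p a * p v) * rdiv_rev_word s' * x a else 0
  else 0.

Definition free_rdiv : {linear free_alg k V -> A} :=
  lin_ext (fun m : {fmonom V} => rdiv_rev_word (rev m)).

Lemma free_rdivD f g : free_rdiv (f + g) = free_rdiv f + free_rdiv g.
Proof. exact: raddfD. Qed.

Lemma free_rdiv0 : free_rdiv 0 = 0.
Proof. exact: raddf0. Qed.

Lemma free_rdivU c m : free_rdiv << c *g m >> = c *: rdiv_rev_word (rev m).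
Proof. exact: lin_extU. Qed.

(** Together with [caseZ] and [case0]: the right-hand side of the division rule is linear in the
    pair formed by the dividend and its quotient. *)
Let caseD (B : nzRingType) (b b' : bool) (s t f g f' g' : B) :
  (if b then f else if b' then s * f' * t else 0) +
  (if b then g else if b' then s * g' * t else 0) =
  if b then f + g else if b' then s * (f' + g') * t else 0.
Proof. by case: b; case: b' => //; rewrite ?addr0 // mulrDr mulrDl. Qed.

Let caseZ (B : algType k) c (b b' : bool) (s t f f' : B) :
  c *: (if b then f else if b' then s * f' * t else 0) =
  if b then c *: f else if b' then s * (c *: f') * t else 0.
Proof.
by case: b; case: b' => //; rewrite ?scaler0 // -scalerAr -scalerAl.
Qed.

Let case0 (B : nzRingType) (b b' : bool) (s t f f' : B) :
  f = 0 -> f' = 0 -> (if b then f else if b' then s * f' * t else 0) = 0.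
Proof. by move=> -> ->; case: b; case: b' => //; rewrite mulr0 mul0r. Qed.

Let malgMU (c : k) (m : {fmonom V}) a :
  << c *g m >> * free_gen k a = << c *g mmul m (fmu a) >> :> free_alg k V.
Proof. by rewrite malgM_def fgmulUU mulr1. Qed.

(** Appending [a] to a word puts it first in the reversed word, so on words this is the defining
    recursion; both sides are linear in [f]. *)
Lemma free_rdivM f a :
  free_rdiv (f * free_gen k a) =
    if a == v then \pi_A f
    else if e a v then (-1) ^+ (p a * p v) * free_rdiv f * x a else 0.
Proof.
elim/malg_ind: f => [|f g hf hg|c m].
- have -> : 0 * free_gen k a = 0 :> free_alg k V by exact: mul0r.
  apply: etrans free_rdiv0 (esym _); apply: case0; last exact: free_rdiv0.
  exact: (raddf0 \pi_A).
- have -> : (f + g) * free_gen k a = f * free_gen k a + g * free_gen k a.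
    exact: mulrDl.
  have -> : \pi_A (f + g) = \pi_A f + \pi_A g by exact: (raddfD \pi_A).
  rewrite !free_rdivD; apply: etrans (congr2 +%R hf hg) _.
  exact: caseD.
- rewrite malgMU !free_rdivU fmM fmU rev_cat /= revK fmK.
  rewrite -(graph_alg_scale_malgU e p c); exact: caseZ.
Qed.

Lemma free_rdiv_ker f g :
  \pi_A f = 0 -> free_rdiv f = 0 -> free_rdiv (f * g) = 0.
Proof.
move=> pf0 f0; elim/malg_ind: g => [|g h hg hh|c m].
- have -> : f * 0 = 0 by exact: mulr0.
  exact: free_rdiv0.
- have -> : f * (g + h) = f * g + f * h by exact: mulrDr.
  apply: etrans (free_rdivD _ _) _; apply: etrans (congr2 +%R hg hh) _.
  exact: addr0.
(* The class in [A] is tracked along with the quotient, because dividing by a final letter [v]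
   returns that class. The induction removes the last letter of [m]. *)
suff [_] : \pi_A (f * << c *g m >>) = 0 /\
    free_rdiv (f * << c *g m >>) = 0 by [].
rewrite -[m]fmK; elim/last_ind: {m}(fmonom_val m) => [|s a [ps fs]].
  have -> : f * << c *g FMonom [::] >> = c *: f.
    by rewrite -fmoneE -mul_malgC free_alg_constC.
  split; last by apply: etrans (linearZ_LR _ _ _) _; rewrite /= f0 scaler0.
  by rewrite -graph_alg_scale_pi pf0; exact: scaler0.
have -> : f * << c *g FMonom (rcons s a) >> =
    f * << c *g FMonom s >> * free_gen k a.
  apply: etrans (mulrA _ _ _); congr (f * _); rewrite malgMU.
  congr (<< _ *g _ >>); by rewrite -cats1 [RHS]fmmulE fmuE.
split; last by apply: etrans (free_rdivM _ _) (case0 _ _ _ _ _ _).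
by rewrite graph_alg_piM ps; exact: mul0r.
Qed.

(** This lets right division descend to the quotient algebra. *)
Lemma free_rdiv_ideal f : f \in graph_ideal e p -> free_rdiv f = 0.
Proof.
move=> /graph_idealP hf.
pose P : {rmorphism free_alg k V -> A} := \pi_A.
pose D : {additive free_alg k V -> A} := free_rdiv.
apply: (@rdiv_ideal V e p e_sym e_irr (free_alg k V) A P D (@free_gen k V) v
  _ _ _ (graph_relator e p) f _ hf).
- exact: graph_genC.
- exact: free_rdivM.
- exact: free_rdiv_ker.
- by move=> r.
Qed.

Definition rdiv (a : A) : A := free_rdiv (repr a).

Lemma rdiv_pi f : rdiv (\pi_A f) = free_rdiv f.
Proof.
apply/eqP; rewrite -subr_eq0; apply/eqP.
rewrite /rdiv -[LHS](raddfB free_rdiv); apply: free_rdiv_ideal.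
by apply/graph_alg_piE; rewrite reprK.
Qed.

Lemma rdiv_zmod : zmod_morphism rdiv.
Proof.
elim/graph_alg_ind=> f; elim/graph_alg_ind=> g.
by rewrite -(raddfB \pi_A) !rdiv_pi raddfB.
Qed.

Lemma rdivM a s :
  rdiv (a * x s) =
    if s == v then a
    else if e s v then (-1) ^+ (p s * p v) * rdiv a * x s else 0.
Proof.
elim/graph_alg_ind: a => f; rewrite -graph_alg_piM !rdiv_pi.
exact: free_rdivM.
Qed.

End RightDivision.

(** * Generators of the augmentation ideal *)

Section AugmentationIdeal.
Variables (k : fieldType) (V : finType) (e : rel V) (p : V -> nat).
Local Notation A := (graph_alg k e p).
Local Notation x := (graph_gen k e p).
Local Notation aug := (@graph_alg_aug k V e p).

(** Every nonempty word ends in a letter, so the generators generate the augmentation ideal as a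
    left ideal. The proof keeps the constant term to have a statement linear in [a]. *)
Lemma aug_eq0 (a : A) : aug a = 0 -> exists b : V -> A, a = \sum_v b v * x v.
Proof.
suff h : exists b : V -> A, a = (aug a)%:A + \sum_v b v * x v.
  by move=> a0; have [b] := h; rewrite a0 scale0r add0r; exists b.
elim/graph_alg_ind: a => f; rewrite graph_alg_aug_pi.
elim/malg_ind: f => [|f g [b hb] [c hc]|c m].
- exists (fun=> 0); rewrite raddf0 mcoeff0 scale0r add0r big1 // => v _.
  exact: mul0r.
- exists (fun v => b v + c v); rewrite (raddfD \pi_A) /= hb hc mcoeffD scalerDl.
  under [in RHS]eq_bigr do rewrite mulrDl.
  by rewrite big_split addrACA.
rewrite -[m]fmK; case/lastP: (fmonom_val m) => [|s a].
  exists (fun=> 0); rewrite big1 ?addr0 => [|v _]; last exact: mul0r.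
  have -> : << c *g FMonom [::] >> = c *: 1 :> free_alg k V.
    by rewrite -fmoneE scale_malgU.
  rewrite mcoeffZ mcoeff1 eqxx mulr1 -graph_alg_scale_pi.
  by congr (c *: _); exact: rmorph1.
exists (fun v => if v == a then \pi_A << c *g FMonom s >> else 0).
rewrite (bigD1 a) //= eqxx big1 => [|v /negPf->]; last exact: mul0r.
rewrite -graph_alg_piM.
have -> : << c *g FMonom s >> * free_gen k a = << c *g FMonom (rcons s a) >>.
  rewrite malgM_def fgmulUU mulr1; congr (<< _ *g _ >>).
  by rewrite -cats1 [LHS]fmmulE fmuE.
rewrite mcoeffU fmP fm1 -size_eq0 size_rcons mulr0n scale0r add0r.
exact/esym/addr0.
Qed.

End AugmentationIdeal.

(** * The Koszul complex *)

Section CliqueSign.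
Variables (V : finType) (p : V -> nat).

(* Moving [s] past [t] costs the sign -1 of an exterior product and the sign
   (-1) ^ (p t * p s) of the graded commutator. *)
Definition sign_exp (S : {set V}) (s : V) : nat :=
  \sum_(t in S | (enum_rank t < enum_rank s)%N) (1 + p t * p s).

Lemma sign_expU1 (S : {set V}) s t : t \notin S ->
  sign_exp (t |: S) s =
    ((if (enum_rank t < enum_rank s)%N then 1 + p t * p s else 0) +
     sign_exp S s)%N.
Proof. by move=> tS; rewrite /sign_exp !big_mkcondr big_setU1. Qed.

Lemma sign_expU1id S s : sign_exp (s |: S) s = sign_exp S s.
Proof.
rewrite /sign_exp; apply: eq_bigl => t; rewrite !inE.
by case: (eqVneq t s) => // ->; rewrite ltnn !andbF.
Qed.

Lemma sign_expD1id S s : sign_exp (S :\ s) s = sign_exp S s.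
Proof.
rewrite /sign_exp; apply: eq_bigl => t; rewrite !inE.
by case: (eqVneq t s) => // ->; rewrite ltnn !andbF.
Qed.

(** Exactly one of [s] and [v] precedes the other, so on the left the pair contributes
    [1 + p s * p v] exactly once, while on the right-hand exponents it is absent. The parity of this
    identity makes the mixed terms of [d h + h d] cancel. *)
Lemma sign_exp_swap (S : {set V}) s v : s \in S -> v \notin S ->
  (sign_exp S v + sign_exp (v |: S) s =
   (sign_exp (S :\ s) v + sign_exp S s + p s * p v).+1)%N.
Proof.
move=> sS vS; have sv : s != v by apply: contraNneq vS => <-.
rewrite sign_expU1 // -{1}(setD1K sS) sign_expU1; last by rewrite !inE eqxx.
case: ltngtP => [lt|lt|/val_inj/enum_rank_inj E].
- by rewrite add0n add1n !addSn [(p s * p v + _)%N]addnC addnAC.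
- by rewrite add0n add1n mulnC addSn addnS; congr _.+1; rewrite addnCA addnC.
- by rewrite E eqxx in sv.
Qed.

(** The previous identity for [S :\ t], in the form used for [d d = 0]. *)
Lemma sign_exp_swapD1 (S : {set V}) s t : s \in S -> t \in S -> s != t ->
  (sign_exp S t + sign_exp S s =
   (sign_exp (S :\ s) t + sign_exp (S :\ t) s + p s * p t).+1)%N.
Proof.
move=> sS tS st; have := @sign_exp_swap (S :\ t) s t.
rewrite !inE eqxx st sS => /(_ isT isT); rewrite setD1K // sign_expD1id => ->.
by rewrite setDDl setUC -setDDl sign_expD1id.
Qed.

End CliqueSign.

(** Each term above the diagonal is paired with its mirror image. Since 2 may be a zero divisor in
    [M], the vanishing of the diagonal is a separate assumption. *)
Lemma antisymmetric_sum (M : zmodType) (I : finType) (f : I -> I -> M) :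
  (forall i, f i i = 0) -> (forall i j, i != j -> f i j + f j i = 0) ->
  \sum_i \sum_j f i j = 0.
Proof.
move=> f0 fA; pose lt (i j : I) := (enum_rank i < enum_rank j)%N.
have -> : \sum_i \sum_j f i j =
    \sum_i \sum_(j | lt i j) f i j + \sum_i \sum_(j | lt j i) f i j.
  rewrite -big_split; apply: eq_bigr => i _ /=.
  rewrite (bigID (lt i)) /=; congr (_ + _).
  rewrite (bigD1 i) /=; last by rewrite /lt ltnn.
  rewrite f0 add0r; apply: eq_bigl => j; rewrite /lt -leqNgt ltn_neqAle andbC.
  by rewrite (inj_eq val_inj) (inj_eq enum_rank_inj).
rewrite [X in _ + X](exchange_big_dep xpredT) //= -big_split big1 // => i _ /=.
rewrite -big_split big1 // => j ij; apply: fA.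
by apply: contraTneq ij => ->; rewrite /lt ltnn.
Qed.

(** * The Koszul complex over an algebra with right division by its generators *)

Section Koszul.
Variables (k : fieldType) (B : algType k).
Variables (gr : nat -> B -> Prop) (aug : {rmorphism B -> k}).
Variable pr : nat -> B -> B.
Hypothesis prD : forall q, {morph pr q : a b / a + b}.
Hypothesis gr_pr : forall q a, gr q (pr q a).
Hypothesis pr_gr : forall q r a, gr q a -> pr r a = if r == q then a else 0.
Hypothesis grM : forall i j a b, gr i a -> gr j b -> gr (i + j) (a * b).
Hypothesis aug_gr : forall q a, gr q a -> q = 0 \/ aug a = 0.
Hypothesis gr1 : gr 0 1.
Hypothesis aug_scalar : forall c : k, aug c%:A = c.

Variables (V : finType) (e : rel V) (p : V -> nat).
Hypothesis e_sym : symmetric e.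
Variables (x : V -> B) (D : V -> B -> B).
Hypothesis gr_x : forall n v, gr (p v) ((-1) ^+ n * x v).
Hypothesis aug_x : forall v, aug (x v) = 0.
Hypothesis aug_ker : forall a, aug a = 0 -> exists b : V -> B,
  a = \sum_v b v * x v.
Hypothesis x_comm : forall a b, e a b ->
  x a * x b = (-1) ^+ (p a * p b) * (x b * x a).
Hypothesis D_zmod : forall v, zmod_morphism (D v).
Hypothesis D_x : forall v a s, D v (a * x s) =
  if s == v then a
  else if e s v then (-1) ^+ (p s * p v) * D v a * x s else 0.

HB.instance Definition _ v :=
  GRing.isZmodMorphism.Build B B (D v) (@D_zmod v).

Local Notation N := (sign_exp p).

Implicit Types (S T : {set V}) (n : nat).

Definition koszul_pred n (S : {set V}) : bool := is_clique e S && (#|S| == n).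

Definition koszul_basis n : finType := {S : {set V} | koszul_pred n S}.

Definition koszul_deg n (y : koszul_basis n) : nat := \sum_(v in val y) p v.

(* The basis element e_S, with junk value 0 unless S is an [n]-clique. *)
Definition koszul_elt n (S : {set V}) : {malg B[koszul_basis n]} :=
  oapp (fun y : koszul_basis n => << y >>) 0 (insub S).

Lemma koszul_elt_val n (y : koszul_basis n) : koszul_elt n (val y) = << y >>.
Proof. by rewrite /koszul_elt valK. Qed.

Lemma koszul_elt0 n S : ~~ koszul_pred n S -> koszul_elt n S = 0.
Proof. by move=> h; rewrite /koszul_elt insubN. Qed.

Lemma is_cliqueP (S : {set V}) :
  reflect {in S &, forall a b, a != b -> e a b} (is_clique e S).
Proof.
apply: (iffP forall_inP) => h a.
  by move=> b aS bS ab; have /forall_inP/(_ b bS)/implyP := h a aS; apply.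
by move=> aS; apply/forall_inP => b bS; apply/implyP; exact: h.
Qed.

Lemma sub_clique S T :
  S \subset T -> is_clique e T -> is_clique e S.
Proof.
move=> /subsetP ST /is_cliqueP h; apply/is_cliqueP => a b /ST + /ST.
exact: h.
Qed.

Lemma koszul_predD1 n S s : koszul_pred n.+1 S -> s \in S ->
  koszul_pred n (S :\ s).
Proof.
move=> /andP[cS] + sS; rewrite (cardsD1 s) sS add1n eqSS /koszul_pred => ->.
by rewrite (sub_clique _ cS) // subD1set.
Qed.

Definition koszul_diff n :
    {malg B[koszul_basis n.+1]} -> {malg B[koszul_basis n]} :=
  lin_ext (fun y : koszul_basis n.+1 =>
    \sum_(s in val y) ((-1) ^+ N (val y) s * x s) *: koszul_elt n (val y :\ s)).

HB.instance Definition _ n := GRing.Linear.on (@koszul_diff n).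

Lemma koszul_diffZ n a (z : {malg B[koszul_basis n.+1]}) :
  koszul_diff (a *: z) = a *: koszul_diff z.
Proof. exact: linearZ_LR. Qed.

Lemma koszul_diff_sum n (I : Type) (r : seq I) (P : pred I)
    (z : I -> {malg B[koszul_basis n.+1]}) :
  koszul_diff (\sum_(i <- r | P i) z i) = \sum_(i <- r | P i) koszul_diff (z i).
Proof. exact: linear_sum. Qed.

Lemma koszul_diff0 n : koszul_diff (0 : {malg B[koszul_basis n.+1]}) = 0.
Proof. exact: linear0. Qed.

(** The differential is linear on the left, so [x s] multiplies the coefficient on the right; this
    is why right division is what inverts it. *)
Lemma koszul_diffE n a S : koszul_pred n.+1 S ->
  koszul_diff (a *: koszul_elt n.+1 S) =
  \sum_(s in S) (a * ((-1) ^+ N S s * x s)) *: koszul_elt n (S :\ s).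
Proof.
move=> hS; pose y : koszul_basis n.+1 := exist _ S hS.
rewrite -[S]/(val y) koszul_elt_val koszul_diffZ.
rewrite [koszul_diff _]lin_extU scale1r.
by rewrite scaler_sumr; apply: eq_bigr => s _; rewrite scalerA.
Qed.

Lemma koszul_comb_coeff n (b : koszul_basis n -> B) y :
  (\sum_y' b y' *: koszul_elt n (val y'))@_y = b y.
Proof.
rewrite raddf_sum (bigD1 y) //= big1 => [|y' /negPf y'y].
  by rewrite addr0 koszul_elt_val mcoeffZ mcoeffUU mulr1.
by rewrite koszul_elt_val mcoeffZ mcoeffU y'y mulr0n mulr0.
Qed.

Lemma koszul_expand n (z : {malg B[koszul_basis n]}) :
  z = \sum_(y : koszul_basis n) z@_y *: koszul_elt n (val y).
Proof. by apply/malgP=> y; rewrite koszul_comb_coeff. Qed.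

Lemma koszul_elt_coeff n a S (y : koszul_basis n) :
  (a *: koszul_elt n S)@_y = if S == val y then a else 0.
Proof.
rewrite mcoeffZ /koszul_elt; case: insubP => [y' _ <- /=|].
  by rewrite mcoeffU val_eqE; case: eqP; rewrite ?mulr1 // mulr0n mulr0.
by case: eqP => [->|_ _]; [rewrite valP | rewrite mcoeff0 mulr0].
Qed.

Lemma koszul_elt_homog n S :
  free_homog gr (@koszul_deg n) (\sum_(v in S) p v) (koszul_elt n S).
Proof.
have g0 q : gr q 0.
  have <- : pr q 0 = 0 by apply: (addrI (pr q 0)); rewrite -prD !addr0.
  exact: gr_pr.
move=> y; rewrite -[koszul_elt n S]scale1r koszul_elt_coeff.
case: (S =P val y) => [->|_]; last by case: ifP.
by rewrite /koszul_deg leqnn subnn.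
Qed.

Lemma koszul_diff_homog n :
  homog_map gr (@koszul_deg n.+1) (@koszul_deg n) (@koszul_diff n).
Proof.
apply: (lin_ext_homog prD gr_pr pr_gr grM) => y.
rewrite -big_enum; apply: (free_homog_sum prD gr_pr pr_gr) => s.
rewrite mem_enum => sy; rewrite /koszul_deg (big_setD1 s) //=.
by apply: (free_homogZ prD gr_pr grM) => //; exact: koszul_elt_homog.
Qed.

(** Removing [s] then [t], or [t] then [s], leaves the same clique; the two terms cancel by the
    commutation relation of the edge and the parity in [sign_exp_swapD1]. *)
Lemma koszul_diff_elt2 n S : koszul_pred n.+2 S ->
  koszul_diff (koszul_diff (koszul_elt n.+2 S)) = 0.
Proof.
move=> hS; rewrite -[koszul_elt n.+2 S]scale1r koszul_diffE // koszul_diff_sum.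
(* The double sum is extended by zero to all pairs of vertices, so that it is visibly
   antisymmetric. *)
pose f s t : {malg B[koszul_basis n]} :=
  if [&& s \in S, t \in S & s != t] then
    ((-1) ^+ N S s * x s * ((-1) ^+ N (S :\ s) t * x t)) *:
      koszul_elt n (S :\ s :\ t)
  else 0.
rewrite (eq_bigr (fun s => \sum_t f s t)) => [|s sS]; last first.
  rewrite /= koszul_diffE ?koszul_predD1 // mul1r big_mkcond.
  apply: eq_bigr => t _; rewrite /f sS !inE andbC [s == t]eq_sym.
  by case: (t \in S); case: (t != s).
rewrite big_mkcond (eq_bigr (fun s => \sum_t f s t)) => [|s _]; last first.
  by case: ifP => // sS; rewrite big1 // => t _; rewrite /f sS.
apply: antisymmetric_sum => [s|s t st]; first by rewrite /f eqxx !andbF.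
rewrite /f [t == s]eq_sym st !andbT.
have [sS|_] := boolP (s \in S); last by rewrite andbF; exact: addr0.
have [tS|_] := boolP (t \in S); last exact: addr0.
rewrite /= [S :\ t :\ s]setDDl setUC -setDDl -scalerDl.
have est : e s t by have /andP[/is_cliqueP h _] := hS; exact: h.

rewrite !mulrACA_sign x_comm // mulrA -exprD addr_sign_odd ?scale0r //.
have /(congr1 odd) := sign_exp_swapD1 p sS tS st.
by rewrite /= !oddD; do 5!case: (odd _).
Qed.


Lemma koszul_diffK n (z : {malg B[koszul_basis n.+2]}) :
  koszul_diff (koszul_diff z) = 0.
Proof.
pose dd : {linear _ -> _} := @koszul_diff n \o @koszul_diff n.+1.
suff /(_ z) : dd =1 \0 by [].
apply: linear_malg_eq => y; rewrite /dd /= -koszul_elt_val.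
by apply: koszul_diff_elt2; exact: valP.
Qed.

(** Right division is additive but not linear over [B], so the map is written through coordinates
    and not by [lin_ext]. The junk value of [koszul_elt] removes the terms in which [v |: val y] is
    not a clique of size [n.+1]. *)
Definition koszul_homotopy v n (z : {malg B[koszul_basis n]}) :
    {malg B[koszul_basis n.+1]} :=
  \sum_(y : koszul_basis n)
    ((-1) ^+ N (val y) v * D v z@_y) *: koszul_elt n.+1 (v |: val y).

Fact koszul_homotopy_zmod v n : zmod_morphism (@koszul_homotopy v n).
Proof.
move=> z w; rewrite /koszul_homotopy -sumrB; apply: eq_bigr => y _.
by rewrite mcoeffB raddfB mulrBr scalerBl.
Qed.

HB.instance Definition _ v n := GRing.isZmodMorphism.Build
  {malg B[koszul_basis n]} {malg B[koszul_basis n.+1]} (@koszul_homotopy v n)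
  (@koszul_homotopy_zmod v n).

Lemma koszul_homotopy_sum v n (I : Type) (r : seq I) (P : pred I)
    (z : I -> {malg B[koszul_basis n]}) :
  koszul_homotopy v (\sum_(i <- r | P i) z i) =
  \sum_(i <- r | P i) koszul_homotopy v (z i).
Proof. exact: raddf_sum. Qed.

Lemma koszul_homotopyE v n a S : koszul_pred n S ->
  koszul_homotopy v (a *: koszul_elt n S) =
  ((-1) ^+ N S v * D v a) *: koszul_elt n.+1 (v |: S).
Proof.
move=> hS; pose y : koszul_basis n := exist _ S hS.
rewrite /koszul_homotopy (bigD1 y) //= koszul_elt_coeff eqxx.
rewrite big1 ?addr0 // => y' /negPf y'y; rewrite koszul_elt_coeff.
by rewrite -[S]/(val y) val_eqE eq_sym y'y raddf0 mulr0 scale0r.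
Qed.

Lemma koszul_predU1 n S v :
  v \in S -> koszul_pred n S -> ~~ koszul_pred n.+1 (v |: S).
Proof.
move=> vS /andP[_ /eqP <-]; rewrite /koszul_pred cardsU1 vS /= andbC.
by rewrite eqn_leq ltnn andbF.
Qed.

(** The operator [d h + h d] is diagonal, by three cases on [v] and [S]. The clause on [a = 0]
    ensures that a coefficient once made zero stays zero when further vertices are treated. *)
Lemma koszul_homotopy_elt v n a S : koszul_pred n.+1 S ->
  exists2 b, koszul_diff (koszul_homotopy v (a *: koszul_elt n.+1 S)) +
      koszul_homotopy v (koszul_diff (a *: koszul_elt n.+1 S)) =
      b *: koszul_elt n.+1 S &
    (v \in S -> b = a) /\ (a = 0 -> b = 0).
Proof.
move=> hS; have [->|a0] := eqVneq a 0.
  by exists 0 => //; rewrite scale0r raddf0 !koszul_diff0 raddf0 addr0.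
have -> : koszul_homotopy v (koszul_diff (a *: koszul_elt n.+1 S)) =
    \sum_(s in S) ((-1) ^+ N (S :\ s) v *
      D v (a * ((-1) ^+ N S s * x s))) *: koszul_elt n.+1 (v |: S :\ s).
  rewrite koszul_diffE // koszul_homotopy_sum; apply: eq_bigr => s sS.
  by rewrite koszul_homotopyE // koszul_predD1.
rewrite koszul_homotopyE //.
have Dax s : D v (a * ((-1) ^+ N S s * x s)) = (-1) ^+ N S s * D v (a * x s).
  by rewrite mulr_signCA raddfMsign.
have [vS|vS] := boolP (v \in S).
  (* Here [h] kills the element, and in [h d] only the term [s = v] survives: dividing [a * x v] by
     [v] gives back [a]. *)
  exists a; last by split=> // E; rewrite E eqxx in a0.
  rewrite (koszul_elt0 (koszul_predU1 vS hS)) scaler0 koszul_diff0 add0r.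
  rewrite (bigD1 v) //= big1 ?addr0 => [|s /andP[sS sv]].
    rewrite (setD1K vS) Dax D_x eqxx sign_expD1id.
    by rewrite signrMK.
  rewrite koszul_elt0 ?scaler0 // koszul_predU1 ?koszul_predD1 //.
  by rewrite !inE eq_sym sv.
have [cU|cU] := boolP (is_clique e (v |: S)); last first.
  exists 0; last by split=> // E; rewrite E eqxx in a0.
  rewrite koszul_elt0 ?scaler0 ?koszul_diff0 ?add0r; last first.
    by rewrite /koszul_pred negb_and cU.
  rewrite big1 ?scale0r // => s sS; rewrite Dax D_x.
  have -> : (s == v) = false by apply: contraNF vS => /eqP <-.
  case: ifP => [sv|_]; last by rewrite !mulr0 scale0r.
  rewrite koszul_elt0 ?scaler0 // /koszul_pred negb_and.
  (* If [v |: S :\ s] were a clique, then, [s] being adjacent to [v], the whole of [S] would be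
     adjacent to [v], and [v |: S] would be a clique. *)
  rewrite (contra _ cU) // => /is_cliqueP h.
  have /andP[/is_cliqueP hS' _] := hS.
  have ev c : c \in S -> e c v.
    move=> cS; have [-> //|cs] := eqVneq c s.
    apply: h; rewrite ?inE ?eqxx ?cs ?cS ?orbT //.
    by apply: contraNneq vS => <-.
  apply/is_cliqueP => b c /setU1P[->|bS] /setU1P[->|cS]; rewrite ?eqxx //.
  - by rewrite e_sym ev.
  - by rewrite ev.
  - exact: hS'.
have hU : koszul_pred n.+2 (v |: S).
  by have /andP[_ cS] := hS; rewrite /koszul_pred cU cardsU1 vS eqSS.
(* The entry is the term of [d h] that removes [v] again; every other [s] contributes one term to
   [d h] and one to [h d], of opposite signs by [sign_exp_swap]. *)
exists (D v a * x v).
2: by split=> [|->]; rewrite ?(negPf vS) // raddf0 mul0r.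
rewrite (koszul_diffE _ hU) [X in X + _](big_setU1 _ vS) /= (setU1K vS) -addrA.
rewrite -big_split.
rewrite -mulrA mulr_signCA sign_expU1id signrMK /= big1 => [|s sS].
  exact: addr0.
have sv : s != v by apply: contraNneq vS => <-.
have esv : e s v.
  by have /is_cliqueP h := cU; apply: h => //; rewrite !inE ?eqxx ?sS ?orbT.
have -> : (v |: S) :\ s = v |: S :\ s.
  rewrite setDUl; congr (_ :|: _); apply/setDidPl.
  by rewrite disjoints1 inE eq_sym.
rewrite -scalerDl Dax D_x (negPf sv) esv mulrACA_sign -!mulrA.
rewrite ![_ * ((-1) ^+ _ * _)]mulrA -!exprD addr_sign_odd ?scale0r //.
have /(congr1 odd) := sign_exp_swap p sS vS.
by rewrite /= !oddD; do 5!case: (odd _).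
Qed.

(** On a cycle [h d] vanishes, so [d h] agrees with the diagonal operator [d h + h d] and can be
    read coordinate by coordinate. *)
Lemma koszul_homotopy_coeff v n (z : {malg B[koszul_basis n.+1]})
    (y : koszul_basis n.+1) : koszul_diff z = 0 ->
  (v \in val y -> (koszul_diff (koszul_homotopy v z))@_y = z@_y) /\
  (z@_y = 0 -> (koszul_diff (koszul_homotopy v z))@_y = 0).
Proof.
move=> dz.
have /boolp.choice[b hb] : forall y' : koszul_basis n.+1, exists c,
    koszul_diff (koszul_homotopy v (z@_y' *: koszul_elt n.+1 (val y'))) +
    koszul_homotopy v (koszul_diff (z@_y' *: koszul_elt n.+1 (val y'))) =
      c *: koszul_elt n.+1 (val y') /\
    (v \in val y' -> c = z@_y') /\ (z@_y' = 0 -> c = 0).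
  move=> y'; have [c E h] := koszul_homotopy_elt v z@_y' (valP y').
  by exists c.
have -> : koszul_diff (koszul_homotopy v z) =
    \sum_y' b y' *: koszul_elt n.+1 (val y').
  have E1 : koszul_diff (koszul_homotopy v z) = \sum_(y' : koszul_basis n.+1)
      koszul_diff (koszul_homotopy v (z@_y' *: koszul_elt n.+1 (val y'))).
    by rewrite {1}[z]koszul_expand koszul_homotopy_sum; exact: koszul_diff_sum.
  have E2 : koszul_homotopy v (koszul_diff z) = \sum_(y' : koszul_basis n.+1)
      koszul_homotopy v (koszul_diff (z@_y' *: koszul_elt n.+1 (val y'))).
    by rewrite {1}[z]koszul_expand koszul_diff_sum; exact: koszul_homotopy_sum.
  have h0 : koszul_homotopy v (koszul_diff z) = 0 by rewrite dz; exact: raddf0.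
  apply: etrans (esym (addr0 _)) _; apply: etrans (congr1 _ (esym h0)) _.
  rewrite E1 E2 -big_split.
  by apply: eq_bigr => y' _; case: (hb y').
rewrite koszul_comb_coeff.
by case: (hb y).
Qed.

(** One vertex at a time, the remainder [w] is replaced by [w - d h_v w]: this clears the
    coordinates at cliques containing [v] and keeps those already cleared. *)
Lemma koszul_reduce (r : seq V) n (z : {malg B[koszul_basis n.+1]}) :
  koszul_diff z = 0 ->
  exists u, forall (y : koszul_basis n.+1) v, v \in r -> v \in val y ->
    (z - koszul_diff u)@_y = 0.
Proof.
move=> dz; elim: r => [|v r [u hu]]; first by exists 0.
set w := z - koszul_diff u in hu.
have dw : koszul_diff w = 0.
  rewrite /w [LHS](raddfB (@koszul_diff n)) /= dz.
  by rewrite koszul_diffK subr0.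
exists (u + koszul_homotopy v w) => y s.
have -> : z - koszul_diff (u + koszul_homotopy v w) =
    w - koszul_diff (koszul_homotopy v w).
  by rewrite [koszul_diff (_ + _)](raddfD (@koszul_diff n.+1)) opprD addrA.
have [h1 h2] := koszul_homotopy_coeff v y dw.
rewrite mcoeffB inE => /orP[/eqP->|sr] sy; first by rewrite h1 ?subrr.
by rewrite h2 (hu y s sr sy) ?subrr.
Qed.

(** After reduction by all vertices nothing remains, since a clique of positive size contains some
    vertex. *)
Lemma koszul_exact n (z : {malg B[koszul_basis n.+1]}) :
  koszul_diff z = 0 <-> exists u, koszul_diff u = z.
Proof.
split=> [/(koszul_reduce (enum V))[u hu]|[u <-]]; last exact: koszul_diffK.
exists u; apply/eqP; rewrite eq_sym -subr_eq0; apply/eqP/malgP => y.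
rewrite mcoeff0; have /andP[_ /eqP cy] := valP y.
have /card_gt0P[v vy] : (0 < #|val y|)%N by rewrite cy.
by apply: (hu y v) => //; rewrite mem_enum.
Qed.

(** * Degree zero, minimality and Tor *)

Lemma koszul_basis0 (y : koszul_basis 0) : val y = set0.
Proof. by have /andP[_ /eqP/cards0_eq] := valP y. Qed.

Lemma koszul_pred0 : koszul_pred 0 set0.
Proof.
rewrite /koszul_pred cards0 eqxx andbT.
by apply/is_cliqueP => a b; rewrite inE.
Qed.

Definition koszul_vertex : koszul_basis 0 := exist _ set0 koszul_pred0.

Lemma koszul_basis0E (y : koszul_basis 0) : y = koszul_vertex.
Proof. by apply: val_inj; rewrite koszul_basis0. Qed.

Definition koszul_aug : {malg B[koszul_basis 0]} -> triv_mod aug :=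
  lin_ext (fun _ => (1 : k) : triv_mod aug).

HB.instance Definition _ := GRing.Linear.on koszul_aug.

Lemma koszul_expand0 (z : {malg B[koszul_basis 0]}) :
  z = << z@_koszul_vertex *g koszul_vertex >>.
Proof.
by apply/malgP=> y; rewrite (koszul_basis0E y) mcoeffUU.
Qed.

Lemma koszul_augE z : koszul_aug z = aug z@_koszul_vertex.
Proof.
by rewrite {1}[z]koszul_expand0 [LHS]lin_extU [LHS]mulr1.
Qed.

(** The image of the differential in degree 0 is the left ideal generated by the [x v], which is the
    augmentation ideal by [aug_ker] and [aug_x]. *)
Lemma koszul_exact0 z : koszul_aug z = 0 <-> exists u, koszul_diff u = z.
Proof.
rewrite koszul_augE; split=> [/aug_ker[b hb]|[u <-]].
  exists (\sum_v b v *: koszul_elt 1 [set v]).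
  rewrite [z]koszul_expand0 hb koszul_diff_sum -scale_malgU scaler_suml.
  apply: eq_bigr => v _; rewrite koszul_diffE.
    rewrite big_set1 setDv -[set0]/(val koszul_vertex) koszul_elt_val.
    (* The sign of a one-vertex clique is trivial: its exponent is a sum over the empty set. *)
    rewrite -sign_expD1id setDv /sign_exp big1 ?expr0 ?mul1r // => s.
    by rewrite inE.
  rewrite /koszul_pred cards1 eqxx andbT; apply/is_cliqueP => a c.
  by rewrite !inE => /eqP-> /eqP->; rewrite eqxx.
rewrite [u]koszul_expand koszul_diff_sum raddf_sum /= raddf_sum big1 // => y _.
rewrite /= koszul_diffE; last exact: valP.
rewrite raddf_sum /= raddf_sum big1 // => s _.
by rewrite /= mcoeffZ 3!rmorphM /= aug_x !mulr0 mul0r.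
Qed.

Lemma koszul_aug_homog q z :
  free_homog gr (@koszul_deg 0) q z -> q = 0 \/ koszul_aug z = 0.
Proof.
move=> /(_ koszul_vertex); rewrite /koszul_deg big_set0 subn0 koszul_augE.
exact: aug_gr.
Qed.

Lemma koszul_aug_surj c : exists z, koszul_aug z = c.
Proof.
exists << (c : k)%:A *g koszul_vertex >>.
by rewrite koszul_augE mcoeffUU; exact: aug_scalar.
Qed.

Definition koszul_resolution : graded_free_resolution gr aug :=
  @GradedFreeResolution k B gr aug (fun n => koszul_basis n : choiceType)
    koszul_deg (fun n => @koszul_diff n) koszul_aug koszul_diff_homog
    koszul_aug_homog koszul_aug_surj koszul_exact0 koszul_exact.

(** Every matrix entry of the differential is a multiple of some [x s], hence augments to zero. *)
Lemma koszul_minimal n (u : {malg k[res_basis koszul_resolution n.+1]}) :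
  tor_diff u = 0.
Proof.
suff /(_ u) : tensor_ext aug (@koszul_diff n) =1 \0 by [].
apply: linear_malg_eq => y; rewrite tensor_extU; apply/malgP=> y'.
rewrite coef_augE mcoeff0 -koszul_elt_val -[koszul_elt _ _]scale1r.
rewrite koszul_diffE; last exact: valP.
rewrite raddf_sum /= raddf_sum big1 // => s _.
by rewrite /= mcoeffZ 3!rmorphM /= aug_x !mulr0 mul0r.
Qed.

Hypothesis pr_sum : forall a, exists N, forall M, (N <= M)%N ->
  a = \sum_(q < M) pr q a.

(** By minimality it remains to enumerate the basis elements of degree [q] in the n-th Koszul
    module, which are the cliques counted by [clique_count]. *)
Lemma tor_dim_cliques (F : graded_free_resolution gr aug) n q :
  tor_dim F n q (clique_count e p n q).
Proof.
rewrite /clique_count; set C := [set S | _].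
have hC (i : 'I_#|C|) : koszul_pred n (enum_val i).
  by have := enum_valP i; rewrite inE => /and3P[h1 h2 _]; exact/andP.
pose b i : koszul_basis n := exist _ (enum_val i) (hC i).
apply: (tor_dim_minimal prD gr_pr pr_gr pr_sum grM aug_gr gr1 F
  (G := koszul_resolution) (b := b)).
- exact: koszul_minimal.
- by move=> i j /(congr1 val)/enum_val_inj.
- by move=> i; have := enum_valP i; rewrite inE => /and3P[_ _ /eqP].
- move=> y hy; have yC : val y \in C.
    by have /andP[h1 h2] := valP y; rewrite inE h1 h2; exact/eqP.
  by exists (enum_rank_in yC (val y)); apply: val_inj; rewrite /= enum_rankK_in.
Qed.

End Koszul.

(** * Generating series *)

Lemma clique_count_eq0 (V : finType) (e : rel V) (p : V -> nat) i j :
  (#|V| < i)%N || (\sum_a p a < j)%N -> clique_count e p i j = 0.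
Proof.
move=> ij; apply/eqP; rewrite cards_eq0; apply/eqP/setP=> S; rewrite !inE.
apply: contraTF ij => /and3P[_ /eqP<- /eqP<-]; rewrite negb_or -!leqNgt.
rewrite max_card [leqRHS](bigID (mem S)) /=; exact: leq_addr.
Qed.

Lemma coef_clique_poly (V : finType) (e : rel V) (p : V -> nat) q :
  (clique_poly e p)`_q =
  \sum_(i < #|V|.+1) (clique_count e p i q)%:Z * (-1) ^+ i.
Proof.
rewrite /clique_poly coef_sum; apply: eq_bigr => i _; rewrite coef_sum.
under [LHS]eq_bigr do rewrite coefZ coefXn.
have [lt|ge] := ltnP q (\sum_a p a).+1.
  rewrite (bigD1 (Ordinal lt)) //= eqxx mulr1 big1 ?addr0; first exact: mulrC.
  by move=> j /negPf; rewrite -val_eqE /= eq_sym => ->; rewrite mulr0.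
rewrite clique_count_eq0 ?ge ?orbT // mul0r big1 // => j _.
(* For [q] above the total weight both sides are zero: every exponent [j] stays below [q], and no
   clique has weight [q]. *)
by rewrite gtn_eqF ?mulr0 // (leq_trans (ltn_ord j)).
Qed.

Theorem corollary1p4 (k : fieldType) (hk : 2%N \notin [pchar k])
    (V : finType) (e : rel V) (e_sym : symmetric e) (e_irr : irreflexive e)
    (p : V -> nat) (p_gt0 : forall i, (0 < p i)%N)
    (F : graded_free_resolution (@graph_alg_homog k V e p)
                                (@graph_alg_aug k V e p)) :
  exists P : nat -> nat -> int,
    double_poincare_series F P /\
    series_eval_y P (-1) (fun q => (clique_poly e p)`_q).
Proof.
exists (fun n q => (clique_count e p n q)%:Z); split=> [n q|q]; last first.
  (* No clique has more than [#|V|] vertices, so each power of [z] meets only the powers of [y]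
     below [#|V|.+1]. *)
  exists #|V|.+1; split=> [n hn|]; last exact: coef_clique_poly.
  by rewrite clique_count_eq0 ?hn.
exists (clique_count e p n q) => //.
have aug_scalar (c : k) : graph_alg_aug (c%:A : graph_alg k e p) = c.
  have -> : c%:A = \pi_(graph_alg k e p) c%:MP by exact: mulr1.
  by rewrite graph_alg_aug_pi; exact: mcoeffUU.
apply: (@tor_dim_cliques k (graph_alg k e p) _ (@graph_alg_aug k V e p)
  _ (@graph_prD k V e p) (@graph_pr_homog k V e p)
  (@homog_graph_pr k V e p) (@homogM k V e p) (@homog_aug k V e p)
  (@homog1 k V e p) aug_scalar V e p e_sym (graph_gen k e p)
  (@rdiv k V e p)).
- by move=> n' v; apply: homog_sign; exact: homog_gen.
- exact: aug_gen.
- exact: aug_eq0.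
- exact: graph_genC.
- by move=> v; exact: rdiv_zmod.
- by move=> v; exact: rdivM.
- exact: graph_pr_sum.
Qed.
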